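(* There exist universal constants $C\ge1$ and $\kappa>0$ such that the following holds. For any $0<\gamma<1/C$, any $d\ge C$ ($d\in\mathbb N$), any sample size $m\ge C$ ($m\in\mathbb N$), and any weak-to-strong learner $\mathcal A$ with parallel complexity $(p,t)$, there exist an input domain $\mathcal X$, a distribution $\mathcal D$ over $\mathcal X$, a concept $c\colon\mathcal X\to\{-1,1\}$, and a $\gamma$-weak learner $\mathcal W$ for $c$ using a hypothesis set $\mathcal H\subseteq\{-1,1\}^{\mathcal X}$ of VC-dimension $d$ such that: if the expected loss $\mathcal L_{\mathcal D}$ of the classifier output by $\mathcal A$ on a training set $S\sim\mathcal D^m$ labeled by $c$ and with query access to $\mathcal W$ (expectation over $S$, and over the internal randomness of $\mathcal A$ if any) is at most $m^{-0.01}$, then at least one of the following holds: (i) $p\ge\min\{\exp(\kappa d),\ \kappa\gamma^{-2}\ln m\}$; (ii) $t\ge\exp(\exp(\kappa d))$; (iii) $p\ln t\ge\kappa\gamma^{-2}d\ln m$.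
   Context: Loss. $\mathcal L_{\mathcal D}(h)=\Pr_{x\sim\mathcal D}[h(x)\ne c(x)]$. Weak learner. A $\gamma$-weak learner $\mathcal W$ for $c$ using $\mathcal H$ takes as input a query $(S',c(S'),D)$, where $S'$ is a finite sequence of elements of $\mathcal X$, $c(S')$ is the sequence of its labels under $c$, and $D$ is a probability distribution with support contained in the set of elements of $S'$; it returns some $h\in\mathcal H$ with $\mathcal L_D(h)=\sum_xD(x)\mathbf 1\{h(x)\neq c(x)\}\le1/2-\gamma$. Parallel weak-to-strong learner. A weak-to-strong learner $\mathcal A$ has parallel complexity $(p,t)$ if, given a training sample $S\in\mathcal X^m$ with labels $c(S)$, it proceeds in $p$ consecutive rounds; in round $i$ it submits a set $Q^i$ of at most $t$ queries to the weak learner and receives one hypothesis per query. Each query has the form $(S^i_j,c(S^i_j),D^i_j)$, where the elements of $S^i_j$ are contained in $S$ and the distribution $D^i_j$ has support contained in the elements of $S^i_j$. The set $Q^1$ depends only on $(S,c(S))$, and for $i\ge2$ the set $Q^i$ depends only on $(S,c(S))$, the queries of the previous $i-1$ rounds and the responses to them (and on internal randomness, if $\mathcal A$ is randomized). After $p$ rounds $\mathcal A$ outputs a classifier $f\colon\mathcal X\to\{-1,1\}$ determined by the training data and all hypotheses received (and internal randomness). *)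

(* Defs.v *)
From mathcomp Require Import all_boot all_order all_algebra.
From mathcomp Require Import all_classical all_reals all_analysis.
Set Implicit Arguments.
Unset Strict Implicit.
Unset Printing Implicit Defensive.
Import Order.TTheory GRing.Theory Num.Theory.
Local Open Scope classical_set_scope.
Local Open Scope ring_scope.

(* The label set {-1, 1} is encoded as [bool], with [true] for 1 and [false]
   for -1: labels are only ever compared for equality. *)
Definition classifier (X : Type) : Type := X -> bool.

(* Discrete probability distributions. *)
Record dist (R : realType) (X : choiceType) := Dist {
  mass :> X -> R;
  mass_ge0 : forall x, 0 <= mass x;
  mass_sum1 : (\esum_(x in [set: X]) (mass x)%:E = 1)%E }.

Definition loss (R : realType) (X : choiceType) (D : dist R X)
    (c h : classifier X) : \bar R :=
  \esum_(x in [set x | h x != c x]) (D x)%:E.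

Definition supported_in (R : realType) (X : choiceType) (D : dist R X)
    (s : seq X) : Prop :=
  forall x, D x != 0 -> x \in s.

Definition shattered (X : choiceType) (H : set (classifier X)) (s : seq X) :
    Prop :=
  forall b : classifier X, exists2 h, H h & {in s, h =1 b}.

Definition has_VC_dim (X : choiceType) (H : set (classifier X)) (d : nat) :
    Prop :=
  (exists s : seq X, [/\ uniq s, size s = d & shattered H s]) /\
  (forall s : seq X, uniq s -> shattered H s -> (size s <= d)%N).

(* The response to the query (S', y, D), where y is the sequence of labels of
   the elements of S'. *)
Definition responder (R : realType) (X : choiceType) : Type :=
  seq X -> seq bool -> dist R X -> classifier X.

Definition weak_learner (R : realType) (X : choiceType) (gamma : R)
    (c : classifier X) (H : set (classifier X)) (W : responder R X) : Prop :=
  forall (s : seq X) (D : dist R X), supported_in D s ->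
    H (W s (map c s) D) /\
    (loss D c (W s (map c s) D) <= (1 / 2 - gamma)%:E)%E.

(* Generators of the smallest sigma-algebra on distributions for which every
   D |-> D x is measurable. *)
Definition mass_cylinders (R : realType) (X : choiceType) :
    set (set (dist R X)) :=
  [set E | exists (x : X) (B : set R),
     measurable B /\ E = [set D : dist R X | B (D x)]].

Definition measurable_responder (R : realType) (X : choiceType)
    (W : responder R X) : Prop :=
  forall (s : seq X) (y : seq bool) (x : X),
    <<s @mass_cylinders R X >> [set D | W s y D x].

(* The labels of [qpoints] are attached by the protocol, see [play_round]:
   the labels of sample points are known to the learner. *)
Record query (R : realType) (X : choiceType) := Query {
  qpoints : seq X;
  qdist : dist R X }.

(* The queries of the past rounds with their responses, one sequence per round,
   in chronological order. *)
Definition history (R : realType) (X : choiceType) : Type :=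
  seq (seq (query R X * classifier X)).

(* The internal randomness is a seed drawn once from an arbitrary probability
   space; a deterministic learner is one that ignores it. *)
Record learner (R : realType) (m : nat) (X : choiceType) := Learner {
  seed_display : measure_display;
  seed : measurableType seed_display;
  seed_law : probability seed R;
  rounds : nat;
  next_queries :
    seed -> m.-tuple (X * bool) -> history R X -> seq (query R X);
  final : seed -> m.-tuple (X * bool) -> history R X -> classifier X }.

Definition labeled (X : choiceType) (m : nat) (c : classifier X)
    (S : m.-tuple X) : m.-tuple (X * bool) :=
  [tuple (tnth S i, c (tnth S i)) | i < m].

Definition play_round (R : realType) (m : nat) (X : choiceType)
    (A : learner R m X) (c : classifier X) (W : responder R X)
    (w : seed A) (S : m.-tuple X) (hist : history R X) : history R X :=
  rcons hist
    [seq (q, W (qpoints q) (map c (qpoints q)) (qdist q))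
       | q <- next_queries w (labeled c S) hist].

Definition output (R : realType) (m : nat) (X : choiceType)
    (A : learner R m X) (c : classifier X) (W : responder R X)
    (w : seed A) (S : m.-tuple X) : classifier X :=
  final w (labeled c S) (iter (rounds A) (play_round c W w S) [::]).

Definition parallel_complexity (R : realType) (m : nat) (X : choiceType)
    (A : learner R m X) (p t : nat) : Prop :=
  rounds A = p /\
  forall (w : seed A) (LS : m.-tuple (X * bool)) (hist : history R X),
    (size (next_queries w LS hist) <= t)%N /\
    (forall (i : nat) (q : query R X),
       onth (next_queries w LS hist) i = Some q ->
       {subset qpoints q <= map fst LS} /\ supported_in (qdist q) (qpoints q)).

(* The output is a random classifier, so that its expected loss makes sense. *)
Definition measurable_learner (R : realType) (m : nat) (X : choiceType)
    (A : learner R m X) : Prop :=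
  forall (c : classifier X) (W : responder R X), measurable_responder W ->
  forall (S : m.-tuple X) (x : X),
    measurable [set w : seed A | output c W w S x].

Definition expected_loss (R : realType) (m : nat) (X : choiceType)
    (A : learner R m X) (D : dist R X) (c : classifier X)
    (W : responder R X) : \bar R :=
  \esum_(S in [set: m.-tuple X])
    ((\prod_(i < m) D (tnth S i))%:E *
     \int[seed_law A]_(w in [set: seed A]) loss D c (output c W w S))%E.

(* Main.v *)
(* Probabilistic method. On a large finite domain with the uniform distribution,
   draw the concept [c] uniformly and attach to each of the [p] rounds a batch
   of [r] functions agreeing with [c] at each point with probability
   [(1 + 12 gamma) / 2] and [l = exp (O(d))] functions independent of [c]. The
   weak learner answers a query by the first function, in batch order, that
   has advantage [gamma], and by [c] itself if there is none.

   A query whose light points have a small sum of squared masses is answered by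
   a biased function except with probability [exp (- Omega(d))]; for any other
   query a uniform function succeeds by chance with probability
   [exp (- O(d))], by an exponential change of measure. As the batch of round
   [i] is independent of the queries of that round, a union bound with
   [r] of order [ln t / d] shows that [c] is most likely never returned.

   The learner then knows nothing about [c] at an unseen point but [p r] bits of
   bias [12 gamma], so that it errs there with probability at least of order
   [(1 - 144 gamma ^ 2) ^ (p r)], which exceeds [m ^ (- 1/200)] up to a constant
   factor unless [p r] is of order [ln m / gamma ^ 2]. An exponential moment
   turns this into a bound holding simultaneously with the former event. *)
From HB Require Import structures.
Require Import Defs.
From mathcomp Require Import all_boot all_order all_algebra.
From mathcomp Require Import all_classical all_reals all_analysis.
From mathcomp Require Import measurable_realfun ring lra zify.
Set Implicit Arguments.
Unset Strict Implicit.
Unset Printing Implicit Defensive.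
Import Order.TTheory GRing.Theory Num.Theory.
Local Open Scope classical_set_scope.
Local Open Scope ring_scope.

(** * Biased random functions *)

(** Squaring [1 - x / 2 <= expR (- (x / 2))] reduces this to
    [1 <= (1 + x + x ^+ 2) * (1 - x / 2) ^+ 2]. *)
Lemma expR_le_quad (R : realType) (x : R) : x <= 1 / 3 -> expR x <= 1 + x + x ^+ 2.
Proof.
move=> x3.
have h1 := expR_ge1Dx (- (x / 2)).
have e2 : expR x * expR (- (x / 2)) ^+ 2 = 1.
  by rewrite expr2 -!expRD (_ : _ + _ = 0) ?expR0 //; lra.
have p0 := expR_gt0 x.
set y := expR (- (x / 2)) in h1 e2.
have hx : 0 <= 1 + x + x ^+ 2 by nra.
have : 1 <= (1 + x + x ^+ 2) * y ^+ 2.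
  have : (1 - x / 2) ^+ 2 <= y ^+ 2 by rewrite ler_sqr ?nnegrE; lra.
  move=> /(ler_wpM2l hx); apply: le_trans.
  rewrite (_ : (1 + x + x ^+ 2) * _ = 1 + x ^+ 2 / 4 * (1 - 3 * x + x ^+ 2)); last by field.
  rewrite lerDl mulr_ge0 //; nra.
by rewrite -e2 ler_pM2r // exprn_gt0 // expR_gt0.
Qed.

Lemma expR_opp2 (R : realType) : expR (- 2) <= 1 / 4 :> R.
Proof.
have : expR (- 2) * (expR 1 * expR 1) = 1 :> R.
  by rewrite -!expRD (_ : _ + _ = 0) ?expR0 //; lra.
have := expR_gt0 (- 2 : R); have := expR_ge1Dx (1 : R).
move: (expR 1) (expR (- 2)) => z y z2 y0 yz.
have : 4 <= z * z by nra.
move=> z4; have : y * 4 <= y * (z * z) by rewrite ler_wpM2l // ltW.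
by lra.
Qed.

Section BiasedFunctions.
Variables (R : realType) (X : finType).
Implicit Types (a e : X -> R) (c h : {ffun X -> bool}).

Definition sign (b : bool) : R := if b then 1 else -1.

(** [b] records agreement with the concept and [e] is the mean of its sign: 0 is a fair coin, 1
    forces agreement. *)
Definition bit_law (e : R) (b : bool) : R := (1 + e * sign b) / 2.

Definition fun_law e c h : R := \prod_x bit_law (e x) (h x == c x).

(** The weights need not sum to 1, as truncated distributions occur. For a distribution this is one
    minus twice the loss, so advantage [gamma] means correlation at least [2 * gamma]. *)
Definition corr a c h : R := \sum_x a x * sign (h x == c x).

Lemma sum_bool_eq (F : bool -> R) (b : bool) :
  \sum_b' F (b' == b) = F true + F false.
Proof. by rewrite big_bool; case: b => //=; rewrite addrC. Qed.

Lemma bit_law_ge0 (e : R) b : `|e| <= 1 -> 0 <= bit_law e b.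
Proof. by rewrite ler_norml /bit_law => /andP[? ?]; case: b => /=; lra. Qed.

Lemma sum_bit_law (e : R) : bit_law e true + bit_law e false = 1.
Proof. by rewrite /bit_law /=; lra. Qed.

Lemma fun_law_ge0 e c h : (forall x, `|e x| <= 1) -> 0 <= fun_law e c h.
Proof. by move=> e1; apply: prodr_ge0 => x _; exact: bit_law_ge0. Qed.

Lemma sum_fun_lawM e c (f : X -> bool -> R) :
  \sum_h fun_law e c h * \prod_x f x (h x == c x) =
  \prod_x (bit_law (e x) true * f x true + bit_law (e x) false * f x false).
Proof.
rewrite (eq_bigr (fun h => \prod_x
  (bit_law (e x) (h x == c x) * f x (h x == c x)))); last first.
  by move=> h _; rewrite big_split.
rewrite -(bigA_distr_bigA
  (fun x b => bit_law (e x) (b == c x) * f x (b == c x))).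
apply: eq_bigr => x _.
exact: (sum_bool_eq (fun b => bit_law (e x) b * f x b)).
Qed.

Lemma sum_fun_law e c : \sum_h fun_law e c h = 1.
Proof.
transitivity (\sum_h fun_law e c h * \prod_x (fun _ _ => 1) x (h x == c x)).
  by apply: eq_bigr => h _; rewrite big1 ?mulr1.
by rewrite (sum_fun_lawM e c (fun _ _ => 1)) big1 // => x _; rewrite !mulr1 sum_bit_law.
Qed.

(* Exponential Markov inequality; the cruder [exp x <= 1 + x + x^2] replaces
   Hoeffding's lemma, at the price of the bound on [l * a x]. *)
Lemma corr_lower_tail e a c (l r : R) :
  (forall x, `|e x| <= 1) -> 0 <= l ->
  (forall x, 0 <= a x) -> (forall x, l * a x <= 1 / 3) ->
  \sum_(h | corr a c h < r) fun_law e c h <=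
  expR (r * l - l * (\sum_x a x * e x) + l ^+ 2 * \sum_x a x ^+ 2).
Proof.
move=> e1 l0 a0 la.
apply: (@le_trans _ _ (\sum_h fun_law e c h * expR (l * (r - corr a c h)))).
  rewrite big_mkcond /=; apply: ler_sum => h _.
  have := fun_law_ge0 c h e1.
  case: ifPn => [hr|_] p0; last by rewrite mulr_ge0 // expR_ge0.
  rewrite ler_peMr // -expR0 ler_expR mulr_ge0 //; lra.
rewrite (eq_bigr (fun h => expR (l * r) * (fun_law e c h *
   \prod_x (fun x b => expR (- (l * (a x * sign b)))) x (h x == c x)))); last first.
  by move=> h _; rewrite mulrBr expRD mulrCA /corr mulr_sumr -sumrN expR_sum.
rewrite -mulr_sumr (sum_fun_lawM e c (fun x b => expR (- (l * (a x * sign b))))).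
rewrite -addrA expRD (mulrC r l) ler_pM2l ?expR_gt0 //.
rewrite !mulr_sumr -sumrN -big_split /= expR_sum.
apply: ler_prod => x _; apply/andP; split.
  by rewrite addr_ge0 // mulr_ge0 ?expR_ge0 // bit_law_ge0.
rewrite /bit_law /= !mulr1 !mulrN1 mulrN opprK.
have := la x; have := a0 x; have := e1 x; rewrite ler_norml.
have -> : l ^+ 2 * a x ^+ 2 = (l * a x) ^+ 2 by rewrite exprMn.
have -> : l * (a x * e x) = (l * a x) * e x by rewrite mulrA.
have : 0 <= l * a x by rewrite mulr_ge0.
move: (l * a x) => y y0 /andP[em1 e1x] _ y3.
apply: le_trans (expR_ge1Dx _).
have h1 : expR (- y) <= 1 - y + y ^+ 2.
  by have := @expR_le_quad R (- y); rewrite sqrrN; apply; lra.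
have h2 := expR_le_quad y3.
have : (1 + e x) * expR (- y) <= (1 + e x) * (1 - y + y ^+ 2) by rewrite ler_wpM2l //; lra.
have : (1 - e x) * expR y <= (1 - e x) * (1 + y + y ^+ 2) by rewrite ler_wpM2l //; lra.
lra.
Qed.

(* The density of [fun_law e] with respect to the uniform law has second
   moment [\prod_x (1 + e x ^+ 2)]; the bound below is Cauchy-Schwarz. *)
Lemma uniform_ge_tilted e c (E : pred {ffun X -> bool}) :
  (forall x, `|e x| <= 1) ->
  1 / 2 <= \sum_(h | E h) fun_law e c h ->
  expR (- (2 + \sum_x e x ^+ 2)) <= \sum_(h | E h) fun_law (fun=> 0) c h.
Proof.
move=> e1 E2.
pose rho h : R := \prod_x (1 + e x * sign (h x == c x)).
have lawE h : fun_law e c h = fun_law (fun=> 0) c h * rho h.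
  rewrite /fun_law /rho -big_split /=; apply: eq_bigr => x _.
  by rewrite /bit_law mul0r addr0 mulrC mul1r.
have l0 h : 0 <= fun_law (fun=> 0) c h.
  by apply: fun_law_ge0 => x; rewrite normr0.
set M := expR (\sum_x e x ^+ 2).
have M0 : 0 < M by exact: expR_gt0.
have M4 : 0 <= (4 * M)^-1 by rewrite invr_ge0; lra.
have rho2 : \sum_h fun_law (fun=> 0) c h * rho h ^+ 2 <= M.
  rewrite (eq_bigr (fun h => fun_law (fun=> 0) c h *
    \prod_x (fun x b => (1 + e x * sign b) ^+ 2) x (h x == c x))); last first.
    by move=> h _; rewrite /rho prodrXl.
  rewrite (sum_fun_lawM _ _ (fun x b => (1 + e x * sign b) ^+ 2)) /M expR_sum.
  apply: ler_prod => x _; rewrite /bit_law /=; apply/andP; split.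
    by rewrite addr_ge0 // mulr_ge0 ?sqr_ge0 //; lra.
  apply: le_trans (expR_ge1Dx _); lra.
(* Linearised Cauchy-Schwarz: [rho <= rho ^+ 2 / (4 * M) + M]. The first term integrates to at most
   1/4, which leaves 1/4 for [M] times the uniform mass of [E]. *)
have key h : fun_law e c h <= (4 * M)^-1 * (fun_law (fun=> 0) c h * rho h ^+ 2)
     + M * fun_law (fun=> 0) c h.
  rewrite lawE -subr_ge0.
  rewrite (_ : _ - _ = fun_law (fun=> 0) c h * ((4 * M)^-1 * (rho h - 2 * M) ^+ 2)).
    by apply: mulr_ge0 => //; apply: mulr_ge0 => //; exact: sqr_ge0.
  by field; rewrite gt_eqF.
have : \sum_(h | E h) fun_law e c h <=
    1 / 4 + M * \sum_(h | E h) fun_law (fun=> 0) c h.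
  apply: (le_trans (ler_sum _ (fun h _ => key h))).
  rewrite big_split /= -!mulr_sumr lerD2r.
  have : \sum_(h | E h) (fun_law (fun=> 0) c h * rho h ^+ 2) <= M.
    apply: le_trans rho2; rewrite [leRHS](bigID E) /= lerDl.
    by apply: sumr_ge0 => h _; rewrite mulr_ge0 // sqr_ge0.
  move=> /(ler_wpM2l M4)/le_trans; apply.
  by rewrite le_eqVlt; apply/orP; left; apply/eqP; field; rewrite gt_eqF.
move=> /(le_trans E2) => H.
rewrite opprD expRD -/M (expRN (\sum_x _)) -/M.
have e2 := expR_opp2 R.
rewrite ler_pdivrMr //.
by rewrite mulrC; lra.
Qed.

End BiasedFunctions.

(** * Answering a single query *)

Section QueryDichotomy.
Variables (R : realType) (X : finType) (D : X -> R) (c : {ffun X -> bool}).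
Hypotheses (D0 : forall x, 0 <= D x) (D1 : \sum_x D x = 1).

(* Flipping the values outside [T] preserves this law, and the correlations of
   a function and of its flip add up to twice the mass of [T]. *)
Lemma half_le_heavy_tilt (T : {set X}) (r : R) : r <= \sum_(x in T) D x ->
  1 / 2 <= \sum_(h | r <= corr D c h) fun_law (fun x => (x \in T)%:R : R) c h.
Proof.
move=> rT; set e : X -> R := fun x => (x \in T)%:R.
have e1 x : `|e x| <= 1 by rewrite /e; case: (x \in T); rewrite ?normr1 ?normr0.
pose flip (h : {ffun X -> bool}) := [ffun x => if x \in T then h x else ~~ h x].
have flipK : involutive flip.
  by move=> h; apply/ffunP => x; rewrite !ffunE; case: (x \in T) => //; rewrite negbK.
have law_flip h : fun_law e c (flip h) = fun_law e c h.
  apply: eq_bigr => x _; rewrite ffunE /e /bit_law.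
  by case: ifP => // xT; rewrite !mul0r.
have H h : fun_law e c h <=
    (if r <= corr D c h then fun_law e c h else 0) +
    (if r <= corr D c (flip h) then fun_law e c (flip h) else 0).
  rewrite law_flip; have p0 := fun_law_ge0 c h e1.
  case: ifPn => rh; case: ifPn => rfh; rewrite ?addr0 ?add0r ?lerDl //.
  (* If neither [h] nor its flip reaches [r], then [h] errs somewhere on [T], where this law forces
     agreement. *)
  rewrite (_ : fun_law e c h = 0) //.
  have [x xT hx] : exists2 x, x \in T & h x != c x.
    apply/exists_inP; apply: contraNT rh => /exists_inPn hT.
    move: rfh; apply: contraNT; rewrite -!ltNge => rh.
    have : corr D c h + corr D c (flip h) = 2 * \sum_(x in T) D x.
      rewrite /corr -big_split /= mulr_sumr [RHS]big_mkcond /=.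
      apply: eq_bigr => x _; rewrite ffunE; case: ifPn => [xT|_].
        by have /negPn/eqP -> := hT x xT; rewrite eqxx /=; lra.
      by case: (h x); case: (c x) => /=; lra.
    lra.
  by rewrite /fun_law (bigD1 x) //= (negbTE hx) /e xT /bit_law /= mulrN1 subrr !mul0r.
have : \sum_h fun_law e c h <= \sum_(h | r <= corr D c h) fun_law e c h +
    \sum_(h | r <= corr D c h) fun_law e c h.
  rewrite [X in _ <= _ + X](reindex_inj (inv_inj flipK)) /=.
  rewrite [X in _ <= X + _]big_mkcond [X in _ <= _ + X]big_mkcond -big_split /=.
  by apply: ler_sum.
by rewrite sum_fun_law; lra.
Qed.

(* The light points carry almost all the mass. If their squared masses have a
   large sum, the correlation of a uniform function fluctuates enough to reach
   [2 * g] by chance, otherwise that of a biased function concentrates. *)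
Lemma light_dichotomy (a : X -> R) (g th : R) :
  0 < g -> 12 * g <= 1 -> 2 <= th -> (forall x, 0 <= a x) ->
  (forall x, a x <= 2 * g / (12 * th)) -> 1 / 2 <= \sum_x a x ->
  \sum_(h | corr a c h < 4 * g) fun_law (fun=> 12 * g) c h <= expR (- th) \/
  expR (- (38 * th)) <= \sum_(h | 4 * g <= corr a c h) fun_law (fun=> 0) c h.
Proof.
move=> g0 g1 th2 a0 ak a12.
have g12 x : X -> `|12 * g| <= 1 by move=> _; rewrite ger0_norm //; lra.
set s := \sum_x a x ^+ 2.
have s0 : 0 <= s by apply: sumr_ge0 => x _; exact: sqr_ge0.
have lag x : th / g * a x <= 1 / 6.
  have := ak x; rewrite -(@ler_pM2l _ (th / g)) ?divr_gt0 //; last by lra.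
  by move/le_trans; apply; rewrite le_eqVlt; apply/orP; left; apply/eqP; field;
    rewrite !gt_eqF //; lra.
have [sB|sA] := leP (s * th) (g ^+ 2).
  (* With multiplier [th / g] the exponent is at most [4 * th - 6 * th + th]. *)
  left; apply: (@le_trans _ _ (expR (4 * g * (th / g) -
      th / g * (\sum_x a x * (12 * g)) + (th / g) ^+ 2 * s))).
    apply: corr_lower_tail => //.
    - by move=> x; rewrite ger0_norm; lra.
    - by rewrite divr_ge0; lra.
    - by move=> x; have := lag x; lra.
  rewrite ler_expR -mulr_suml.
  have -> : 4 * g * (th / g) = 4 * th by field; rewrite gt_eqF.
  have -> : th / g * ((\sum_x a x) * (12 * g)) = 12 * th * \sum_x a x.
    by field; rewrite gt_eqF.
  have : (th / g) ^+ 2 * s <= th.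
    rewrite (_ : _ * s = (s * th) * (th / g ^+ 2)); last by field; rewrite gt_eqF.
    apply: (@le_trans _ _ (g ^+ 2 * (th / g ^+ 2))).
      by rewrite ler_wpM2r // divr_ge0 ?sqr_ge0; lra.
    by rewrite le_eqVlt; apply/orP; left; apply/eqP; field; rewrite gt_eqF.
  have : 12 * th * (1 / 2) <= 12 * th * \sum_x a x by rewrite ler_wpM2l //; lra.
  lra.
right.
set u := Num.sqrt s.
have u2 : u ^+ 2 = s by rewrite sqr_sqrtr.
have u0 : 0 < u by rewrite sqrtr_gt0; nra.
have gu : g < u * th.
  rewrite -(@ltr_pXn2r _ 2) ?nnegrE //; [|lra|nra].
  apply: lt_le_trans sA _; rewrite exprMn u2 expr2 mulrA ler_peMr //; [nra|lra].
(* [u] is the standard deviation of the correlation under the uniform law. The tilt [l * a] moves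
   the mean to [4 * g + 2 * u], so multiplier [1 / u] bounds the lower tail by [expR (- 1)]. The
   change of measure costs an exponent [32 * th + 10], at most [38 * th]. *)
pose l := (4 * g + 2 * u) / u ^+ 2.
have l0 : 0 <= l by rewrite divr_ge0 ?sqr_ge0 //; lra.
have gu1 : g / u <= th by rewrite ler_pdivrMr // mulrC ltW.
have gu2 : g ^+ 2 / u ^+ 2 <= th by rewrite ler_pdivrMr ?exprn_gt0 // u2 mulrC ltW.
have la x : l * a x <= 1.
  apply: (@le_trans _ _ (l * (2 * g / (12 * th)))); first by rewrite ler_wpM2l.
  rewrite (_ : _ * _ = (8 * (g ^+ 2 / u ^+ 2) + 4 * (g / u)) / (12 * th)); last first.
    by rewrite /l; field; rewrite !gt_eqF //; lra.
  by rewrite ler_pdivrMr; lra.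
pose e x := l * a x.
have e1 x : `|e x| <= 1 by rewrite /e ger0_norm ?la // mulr_ge0.
have esum : \sum_x a x * e x = 4 * g + 2 * u.
  rewrite (eq_bigr (fun x => l * a x ^+ 2)).
    rewrite -mulr_sumr -/s -u2 /l; field; by rewrite gt_eqF.
  by move=> x _; rewrite /e expr2 mulrCA.
have e2sum : \sum_x e x ^+ 2 <= 32 * th + 8.
  rewrite (eq_bigr (fun x => l ^+ 2 * a x ^+ 2)); last first.
    by move=> x _; rewrite /e exprMn.
  rewrite -mulr_sumr -/s -u2.
  rewrite (_ : _ * _ = (4 * (g / u) + 2) ^+ 2); last first.
    by rewrite /l; field; rewrite gt_eqF.
  have : (g / u) ^+ 2 <= th by rewrite expr_div_n.
  by have := sqr_ge0 (4 * (g / u) - 2); lra.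
have : \sum_(h | corr a c h < 4 * g) fun_law e c h <= 1 / 2.
  apply: (@le_trans _ _ (expR (4 * g * (1 / u) - (1 / u) * (\sum_x a x * e x)
      + (1 / u) ^+ 2 * s))).
    apply: corr_lower_tail => //; first by rewrite divr_ge0 // ltW.
    move=> x; have := lag x; have := a0 x => ax0 lx.
    rewrite mul1r mulrC ler_pdivrMr //.
    have : g * (th / g * a x) <= g * (1 / 6) by rewrite ler_wpM2l // ltW.
    have -> : g * (th / g * a x) = th * a x by field; rewrite gt_eqF.
    by nra.
  rewrite esum -u2 (_ : _ + _ = - 1); last by field; rewrite gt_eqF.
  have h : expR (- 1) * expR 1 = 1 :> R by rewrite -expRD addNr expR0.
  by have := expR_gt0 (- 1 : R); have := expR_ge1Dx (1 : R); nra.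
have := sum_fun_law e c; rewrite (bigID (fun h => corr a c h < 4 * g)) /=.
rewrite [X in _ + X](eq_bigl (fun h => 4 * g <= corr a c h)); last first.
  by move=> h; rewrite leNgt.
move=> tot low.
have Q2 : 1 / 2 <= \sum_(h | 4 * g <= corr a c h) fun_law e c h.
  by move: tot low; lra.
apply: le_trans (uniform_ge_tilted e1 Q2); rewrite ler_expR; lra.
Qed.

(** A point is heavy if its mass is at least [2 * g / (12 * th)]. If at most [12 * th] heavy points
    carry mass [2 * g], agreement on them happens by chance often enough; more than [12 * th] heavy
    points always contain such a set. Otherwise the light points carry half of the mass, and the
    heavy ones lower the correlation by at most [2 * g], whence the threshold [4 * g] for the light
    part. *)
Lemma query_dichotomy (g : R) (th : nat) :
  0 < g -> 12 * g <= 1 -> (2 <= th)%N ->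
  \sum_(h | corr D c h < 2 * g) fun_law (fun=> 12 * g) c h <= expR (- th%:R : R) \/
  expR (- (38 * th%:R) : R) <=
    \sum_(h | 2 * g <= corr D c h) fun_law (fun=> 0) c h.
Proof.
move=> g0 g1 th2.
have thR : 2 <= th%:R :> R by rewrite (ler_nat R 2).
have heavy (T : {set X}) : (#|T| <= 12 * th)%N -> 2 * g <= \sum_(x in T) D x ->
    expR (- (38 * th%:R) : R) <=
    \sum_(h | 2 * g <= corr D c h) fun_law (fun=> 0) c h.
  move=> Tk gT; apply: le_trans (uniform_ge_tilted _ (half_le_heavy_tilt gT)).
    rewrite ler_expR lerN2.
    rewrite (eq_bigr (fun x => if x \in T then 1 else 0)); last first.
      by move=> x _; case: (x \in T); rewrite ?expr1n ?expr0n.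
    rewrite -big_mkcond /= sumr_const.
    have : #|T|%:R <= (12 * th)%:R :> R by rewrite ler_nat.
    by rewrite natrM; lra.
  by move=> x; case: (x \in T); rewrite ?normr1 ?normr0.
pose T := [set x | 2 * g / (12 * th%:R) <= D x]%SET.
have [Tk|kT] := leqP #|T| (12 * th); last first.
  right; have /card_geqP[s [us ss sT]] := ltnW kT.
  apply: (heavy [set:: s]); first by rewrite cardsE (card_uniqP us) ss.
  apply: (@le_trans _ _ (\sum_(x in [set:: s]) 2 * g / (12 * th%:R))).
    rewrite sumr_const cardsE (card_uniqP us) ss -[leRHS]mulr_natr natrM.
    by rewrite mulfVK // gt_eqF //; lra.
  by apply: ler_sum => x; rewrite inE => /sT; rewrite inE.
have [gT|gT] := leP (2 * g) (\sum_(x in T) D x); first by right; exact: (heavy T Tk gT).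
pose a x := if x \in T then 0 else D x.
have corr_ge h : corr a c h - 2 * g <= corr D c h.
  apply: (@le_trans _ _ (corr a c h - \sum_(x in T) D x)); first by lra.
  rewrite /corr [X in _ - X]big_mkcond /= -sumrB; apply: ler_sum => x _.
  by rewrite /a /sign; have := D0 x; case: (x \in T); case: (_ == _) => ?; lra.
have [|||x|x||H|H] := @light_dichotomy a g th%:R => //.
- by rewrite /a; case: ifP.
- rewrite /a; case: ifPn => [_|]; first by rewrite divr_ge0 // ?mulr_ge0 //; lra.
  by rewrite inE -ltNge => /ltW.
- rewrite /a (eq_bigr (fun x => D x - (if x \in T then D x else 0))); last first.
    by move=> x _; case: ifP; rewrite ?subrr ?subr0.
  by rewrite sumrB -big_mkcond /= D1; lra.
- left; apply: le_trans H; rewrite big_mkcond [leRHS]big_mkcond /=.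
  apply: ler_sum => h _; have p0 : 0 <= fun_law (fun=> 12 * g) c h.
    by apply: fun_law_ge0 => x; rewrite ger0_norm; lra.
  case: ifPn => [hr|_]; last by case: ifP.
  by rewrite ifT //; have := corr_ge h; lra.
- right; apply: le_trans H _; rewrite big_mkcond [leRHS]big_mkcond /=.
  apply: ler_sum => h _; have p0 : 0 <= fun_law (fun=> 0 : R) c h.
    by apply: fun_law_ge0 => x; rewrite normr0.
  case: ifPn => [hr|_]; last by case: ifP.
  by rewrite ifT //; have := corr_ge h; lra.
Qed.

End QueryDichotomy.

(** * Pools of random hypotheses *)

Section ProductLaw.
Variables (R : realType) (I T : finType) (w : I -> T -> R).

Definition prod_law (G : {ffun I -> T}) : R := \prod_i w i (G i).

(** Conditioning on the coordinates in [A], with a fresh draw [G] elsewhere: it serves for the past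
    rounds of a pool and for the sample labels of a concept. *)
Definition mix (A : pred I) (G' G : {ffun I -> T}) : {ffun I -> T} :=
  [ffun i => if A i then G' i else G i].

Lemma prod_law_ge0 G : (forall i u, 0 <= w i u) -> 0 <= prod_law G.
Proof. by move=> w0; apply: prodr_ge0. Qed.

Hypothesis w1 : forall i, \sum_u w i u = 1.

Lemma sum_prod_law : \sum_G prod_law G = 1.
Proof. by rewrite -(bigA_distr_bigA w) big1. Qed.

Lemma sum_prod_law_coord (i : I) (f : T -> R) :
  \sum_G prod_law G * f (G i) = \sum_u w i u * f u.
Proof.
pose g k u := w k u * (if k == i then f u else 1).
rewrite (eq_bigr (fun G : {ffun I -> T} => \prod_k g k (G k))).
  rewrite -bigA_distr_bigA (bigD1 i) //= [X in _ * X]big1 ?mulr1.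
    by rewrite /g eqxx.
  move=> k ki; rewrite -[RHS](w1 k); apply: eq_bigr => u _.
  by rewrite /g (negbTE ki) mulr1.
move=> G _; rewrite /g big_split /=; congr (_ * _).
rewrite (bigD1 i) //= eqxx big1 ?mulr1 // => k ki.
by rewrite (negbTE ki).
Qed.

(* Swapping the coordinates outside [A] of two independent copies preserves
   their joint law. *)
Lemma sum_prod_law_mix (A : pred I) (F : {ffun I -> T} -> R) :
  \sum_G' prod_law G' * \sum_G prod_law G * F (mix A G' G) =
  \sum_G prod_law G * F G.
Proof.
transitivity (\sum_(P : {ffun I -> T} * {ffun I -> T})
    prod_law P.1 * prod_law P.2 * F (mix A P.1 P.2)).
  rewrite -(pair_bigA _ (fun G' G => prod_law G' * prod_law G * F (mix A G' G))).
  by apply: eq_bigr => G' _; rewrite mulr_sumr; apply: eq_bigr => G _; rewrite mulrA.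
transitivity (\sum_(P : {ffun I -> T} * {ffun I -> T})
    prod_law P.1 * prod_law P.2 * F P.1); last first.
  rewrite -(pair_bigA _ (fun G' G => prod_law G' * prod_law G * F G')) /=.
  apply: eq_bigr => G' _; rewrite -mulr_suml -mulr_sumr.
  by rewrite sum_prod_law mulr1.
pose swap (P : {ffun I -> T} * {ffun I -> T}) := (mix A P.1 P.2, mix A P.2 P.1).
have swapK : involutive swap.
  case=> G' G; congr (_, _); apply/ffunP => i; rewrite !ffunE;
    by case: (A i).
rewrite [RHS](reindex_inj (inv_inj swapK)) /=; apply: eq_bigr => -[G' G] _ /=.
congr (_ * _); rewrite /prod_law -!big_split /=; apply: eq_bigr => i _.
by rewrite !ffunE; case: (A i); rewrite // mulrC.
Qed.

End ProductLaw.

Section Pools.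
Variables (R : realType) (X J : finType) (p : nat) (bias : J -> R).
Hypothesis bias1 : forall j, `|bias j| <= 1.

Definition batch := {ffun J -> {ffun X -> bool}}.
Definition pool := {ffun 'I_p -> batch}.

Implicit Types (c : {ffun X -> bool}) (G : pool).

Definition batch_law c : batch -> R :=
  prod_law (fun j => fun_law (fun=> bias j) c).

Definition pool_law c : pool -> R := prod_law (fun _ => batch_law c).

Lemma sum_batch_law c : \sum_a batch_law c a = 1.
Proof. by apply: sum_prod_law => j; exact: sum_fun_law. Qed.

Lemma batch_law_ge0 c a : 0 <= batch_law c a.
Proof. by apply: prod_law_ge0 => j h; apply: fun_law_ge0. Qed.

Lemma sum_pool_law c : \sum_G pool_law c G = 1.
Proof. by apply: sum_prod_law => i; exact: sum_batch_law. Qed.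

Lemma pool_law_ge0 c G : 0 <= pool_law c G.
Proof. by apply: prod_law_ge0 => i a; exact: batch_law_ge0. Qed.

(* The queries of round [i] may depend on the batches of the previous rounds
   only, hence are independent of the batch that answers them. *)
Lemma adaptive_union_bound (Q : Type) c (bad : Q -> batch -> bool)
    (queries : 'I_p -> pool -> seq Q) (t : nat) (b : R) :
  0 <= b ->
  (forall q, \sum_(a : batch | bad q a) batch_law c a <= b) ->
  (forall i G, (size (queries i G) <= t)%N) ->
  (forall i G' G, queries i (mix (fun k : 'I_p => (k < i)%N) G' G) = queries i G') ->
  \sum_(G : pool | [exists i, has (bad^~ (G i)) (queries i G)]) pool_law c G
    <= p%:R * t%:R * b.
Proof.
move=> b0 badb szt adapted.
pose N (i : 'I_p) G' G : R := \sum_(q <- queries i G') (bad q (G i))%:R.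
have N0 i G' G : 0 <= N i G' G by apply: sumr_ge0.
apply: (@le_trans _ _ (\sum_G pool_law c G * \sum_i N i G G)).
  rewrite big_mkcond; apply: ler_sum => G _; have P0 := pool_law_ge0 c G.
  case: ifPn => [/existsP[i]|_]; last by rewrite mulr_ge0 // sumr_ge0.
  move=> H; rewrite ler_peMr // (bigD1 i) //= ler_wpDr ?sumr_ge0 //.
  rewrite /N; elim: (queries i G) H => //= q s IH /orP[bq|/IH H]; rewrite big_cons ?bq.
    by rewrite lerDl sumr_ge0.
  by rewrite ler_wpDl.
under eq_bigr do rewrite mulr_sumr.
rewrite exchange_big /=.
apply: (@le_trans _ _ (\sum_(i < p) t%:R * b)); last first.
  by rewrite sumr_const card_ord -mulrA [leRHS]mulr_natl.
apply: ler_sum => i _.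
(* Fixing the batches before round [i] fixes its queries, while batch [i] is fresh since [i < i]
   fails. *)
rewrite -(sum_prod_law_mix (fun _ => sum_batch_law c) (fun k : 'I_p => (k < i)%N)).
rewrite (_ : t%:R * b = (\sum_G pool_law c G) * (t%:R * b)); last first.
  by rewrite sum_pool_law mul1r.
rewrite mulr_suml; apply: ler_sum => G' _.
apply: ler_wpM2l; first exact: pool_law_ge0.
rewrite (eq_bigr (fun G => \sum_(q <- queries i G') pool_law c G * (bad q (G i))%:R));
  last first.
  by move=> G _; rewrite mulr_sumr /N adapted ffunE ltnn.
rewrite exchange_big /=.
apply: (@le_trans _ _ (\sum_(q <- queries i G') b)).
  apply: ler_sum => q _; rewrite [leLHS](sum_prod_law_coord (fun _ => sum_batch_law c) i
    (fun a => (bad q a)%:R)).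
  apply: le_trans (badb q); rewrite [leRHS]big_mkcond /=; apply: ler_sum => a _.
  by case: (bad q a); rewrite ?mulr1 ?mulr0.
by rewrite big_const_seq count_predT iter_addr_0 [leRHS]mulr_natl ler_wpMn2l.
Qed.

Lemma sum_batch_law_all c (P : pred {ffun X -> bool}) :
  \sum_(a : batch | [forall j, P (a j)]) batch_law c a =
  \prod_j \sum_(h | P h) fun_law (fun=> bias j) c h.
Proof.
rewrite big_mkcond /=.
under [RHS]eq_bigr do rewrite big_mkcond /=.
rewrite bigA_distr_bigA /=; apply: eq_bigr => a _.
case: ifPn => [/forallP H|/forallPn[j /negbTE Pj]].
  by apply: eq_bigr => j _; rewrite H.
by rewrite (bigD1 j) //= Pj mul0r.
Qed.

End Pools.

(** In one case of the dichotomy the [r] biased functions are unlikely to fail together, in the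
    other the [l] uniform ones; the sum of both bounds covers either case. *)
Lemma round_failure (R : realType) (X : finType) (D : X -> R)
    (c : {ffun X -> bool}) (g : R) (th r l : nat) (bias : 'I_r + 'I_l -> R) :
  (forall x, 0 <= D x) -> \sum_x D x = 1 ->
  0 < g -> 12 * g <= 1 -> (2 <= th)%N ->
  (forall j, bias (inl j) = 12 * g) -> (forall j, bias (inr j) = 0) ->
  \sum_(a : {ffun 'I_r + 'I_l -> {ffun X -> bool}} |
      [forall j, corr D c (a j) < 2 * g]) batch_law bias c a
    <= expR (- (th * r)%:R) + expR (- (expR (- (38 * th%:R)) * l%:R)).
Proof.
move=> D0 D1 g0 g1 th2 bl br.
rewrite (sum_batch_law_all _ _ (fun h => corr D c h < 2 * g)) big_sumType /=.
under eq_bigr do rewrite bl.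
under [X in _ * X]eq_bigr do rewrite br.
rewrite !prodr_const !card_ord.
set A := \sum_(h | _) fun_law (fun=> 12 * g) c h.
set B := \sum_(h | _) fun_law _ c h.
have le1 (e : R) : `|e| <= 1 ->
    0 <= \sum_(h | corr D c h < 2 * g) fun_law (fun=> e) c h <= 1.
  move=> e1; have l0 h : 0 <= fun_law (fun=> e) c h by apply: fun_law_ge0.
  apply/andP; split; first by apply: sumr_ge0.
  have := sum_fun_law (fun=> e) c.
  rewrite (bigID (fun h => corr D c h < 2 * g)) /=.
  have : 0 <= \sum_(h | ~~ (corr D c h < 2 * g)) fun_law (fun=> e) c h.
    exact: sumr_ge0.
  by lra.
have /andP[A0 A1] : 0 <= A <= 1 by apply: le1; rewrite ger0_norm; lra.
have /andP[B0 B1] : 0 <= B <= 1 by apply: le1; rewrite normr0.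
have [H|H] := query_dichotomy c D0 D1 g0 g1 th2.
  apply: (@le_trans _ _ (expR (- (th * r)%:R))); last by rewrite lerDl expR_ge0.
  rewrite natrM -mulNr expRM_natr -[leRHS]mulr1.
  by apply: ler_pM; rewrite ?exprn_ge0 ?exprn_ile1 ?lerXn2r ?nnegrE ?expR_ge0.
apply: (@le_trans _ _ (expR (- (expR (- (38 * th%:R)) * l%:R)))); last first.
  by rewrite lerDr expR_ge0.
rewrite -mulNr expRM_natr -[leRHS]mul1r.
apply: ler_pM; rewrite ?exprn_ge0 ?exprn_ile1 ?lerXn2r ?nnegrE ?expR_ge0 //.
apply: le_trans (expR_ge1Dx _).
have := sum_fun_law (fun=> 0 : R) c; rewrite (bigID (fun h => corr D c h < 2 * g)) /=.
rewrite -/B [X in _ + X](eq_bigl (fun h => 2 * g <= corr D c h)); last first.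
  by move=> h; rewrite leNgt.
by move: H; lra.
Qed.

(** * Hidden points *)

Section Overlap.
Variables (R : realType) (K : finType) (e : K -> R).
Hypothesis e1 : forall k, `|e k| <= 1.
Implicit Types (b : bool) (v : {ffun K -> bool}).

(** The law of the values of all pool functions, indexed by [K], at one point where the concept
    equals [b]. *)
Definition column_law b v : R := \prod_k bit_law (e k) (v k == b).

Lemma column_law_ge0 b v : 0 <= column_law b v.
Proof. by apply: prodr_ge0 => k _; exact: bit_law_ge0. Qed.

Lemma sum_column_law b : \sum_v column_law b v = 1.
Proof.
rewrite -(bigA_distr_bigA (fun k b' => bit_law (e k) (b' == b))) big1 // => k _.
by rewrite (sum_bool_eq (fun b' => bit_law (e k) b')) sum_bit_law.
Qed.

(** One minus the total variation distance of the two column laws; half of it is the least error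
    probability when guessing a uniform label from its column. *)
Definition overlap : R :=
  \sum_v Num.min (column_law true v) (column_law false v).

Lemma overlap_le1 : overlap <= 1.
Proof.
apply: (@le_trans _ _ (\sum_v column_law true v)).
  by apply: ler_sum => v _; rewrite ge_min lexx.
by rewrite sum_column_law.
Qed.

(* The product of the two laws is the same number [q] at every point. As
   [min a b * max a b = q], for every [s] one has
   [min a b >= q * (2 * s - s ^+ 2 * max a b)], and [s] is optimised below. *)
Lemma overlap_ge : (\prod_k (1 - e k ^+ 2)) / 2 <= overlap.
Proof.
pose q := \prod_k ((1 - e k ^+ 2) / 4).
have q0 : 0 <= q.
  apply: prodr_ge0 => k _; rewrite divr_ge0 // subr_ge0.
  by have := e1 k; rewrite ler_norml => /andP[? ?]; nra.
have qE v : column_law true v * column_law false v = q.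
  rewrite /column_law -big_split /=; apply: eq_bigr => k _.
  by rewrite /bit_law; case: (v k) => /=; field.
(* Bounding [max] by the sum of both laws and summing over [v] gives
   [q * (2 * s * 2 ^+ #|K| - 2 * s ^+ 2)], which this [s] maximises. *)
pose s : R := 2 ^+ #|K| / 2.
have mn v : q * (2 * s) - q * s ^+ 2 * (column_law true v + column_law false v) <=
    Num.min (column_law true v) (column_law false v).
  have := qE v; have := column_law_ge0 true v; have := column_law_ge0 false v.
  move: (column_law true v) (column_law false v) => a b b0 a0 <-.
  have [ab|ba] := leP a b.
    have : 0 <= a * (1 - s * b) ^+ 2 by rewrite mulr_ge0 ?sqr_ge0.
    have : 0 <= (a * b) * s ^+ 2 * a by rewrite !mulr_ge0 ?sqr_ge0.
    by lra.
  have : 0 <= b * (1 - s * a) ^+ 2 by rewrite mulr_ge0 ?sqr_ge0.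
  have : 0 <= (a * b) * s ^+ 2 * b by rewrite !mulr_ge0 ?sqr_ge0.
  by lra.
apply: le_trans (ler_sum _ (fun v _ => mn v)).
rewrite sumrB sumr_const -mulr_sumr big_split /= !sum_column_law.
rewrite card_ffun card_bool -[X in _ <= X - _]mulr_natr natrX.
have -> : \prod_k (1 - e k ^+ 2) = q * (2 ^+ #|K|) ^+ 2.
  rewrite /q -exprM mulnC exprM -[X in _ = _ * X]prodr_const -big_split /=.
  by apply: eq_bigr => k _; field.
by rewrite /s le_eqVlt; apply/orP; left; apply/eqP; field.
Qed.

End Overlap.

Section Transposition.
Variables (R : realType) (X J : finType) (p : nat) (bias : J -> R).
Implicit Types (c : {ffun X -> bool}) (G : pool X J p).

Definition column G (x : X) : {ffun 'I_p * J -> bool} :=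
  [ffun k => G k.1 k.2 x].

Definition column_bias (k : 'I_p * J) : R := bias k.2.

(** The pool is read point by point instead of function by function: given the concept, columns are
    independent and each sees only the label at its own point. *)
Lemma pool_law_columns c G :
  pool_law bias c G = \prod_x column_law column_bias (c x) (column G x).
Proof.
rewrite /pool_law /prod_law /batch_law /prod_law /fun_law /column_law.
rewrite pair_bigA /= exchange_big /=; apply: eq_bigr => x _.
by apply: eq_bigr => k _; rewrite ffunE.
Qed.

Lemma sum_columns (f : X -> {ffun 'I_p * J -> bool} -> R) :
  \sum_G \prod_x f x (column G x) = \prod_x \sum_v f x v.
Proof.
rewrite bigA_distr_bigA /=.
pose tr G : {ffun X -> {ffun 'I_p * J -> bool}} := [ffun x => column G x].
pose rt (V : {ffun X -> {ffun 'I_p * J -> bool}}) : pool X J p :=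
  [ffun i => [ffun j => [ffun x => V x (i, j)]]].
rewrite [RHS](reindex tr) /=.
  by apply: eq_bigr => G _; apply: eq_bigr => x _; rewrite ffunE.
exists rt => [G|V] _.
  by apply/ffunP => i; apply/ffunP => j; apply/ffunP => x; rewrite !ffunE.
by apply/ffunP => x; apply/ffunP => -[i j]; rewrite !ffunE.
Qed.

End Transposition.

Section HiddenPoints.
Variables (R : realType) (X J : finType) (p : nat) (bias : J -> R).
Hypothesis bias1 : forall j, `|bias j| <= 1.
Variables (S : pred X) (f : {ffun X -> bool} -> pool X J p -> X -> bool).
Hypothesis f_mix : forall c' c G, f (mix S c' c) G = f c' G.
Implicit Types (c : {ffun X -> bool}) (G : pool X J p).

Definition concept_law : {ffun X -> bool} -> R := prod_law (fun _ _ => 1 / 2).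

Lemma half_half (T : X) : \sum_(b : bool) (1 / 2 : R) = 1.
Proof. by rewrite big_bool /=; lra. Qed.

Lemma sum_concept_law : \sum_c concept_law c = 1.
Proof. exact: (sum_prod_law half_half). Qed.

Lemma concept_law_ge0 c : 0 <= concept_law c.
Proof. by apply: prod_law_ge0 => x b; lra. Qed.

Definition hidden_errors c G : nat :=
  #|[pred x | ~~ S x && (f c G x != c x)]|.

Let ov := overlap (column_bias (p := p) bias).

Let cb1 : forall k, `|column_bias (p := p) bias k| <= 1.
Proof. by move=> k; exact: bias1. Qed.

(** The guess may use the whole pool but only the sample labels, here those of [c']. At a hidden
    point the weight of the wrong label is halved, so any guess loses at least a quarter of the
    smaller column weight. *)
Lemma hidden_errors_laplace :
  \sum_c concept_law c * \sum_G pool_law bias c G * 2 ^- hidden_errors c G <=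
  (1 - ov / 4) ^+ #|[pred x | ~~ S x]|.
Proof.
have ov1 : ov <= 1 := overlap_le1 _.
rewrite -(sum_prod_law_mix half_half S).
set B := (X in _ <= X).
have -> : B = (\sum_c concept_law c) * B by rewrite sum_concept_law mul1r.
rewrite mulr_suml; apply: ler_sum => c' _.
apply: ler_wpM2l; first exact: concept_law_ge0.
pose P := column_law (column_bias (p := p) bias).
pose F G x b : R := 1 / 2 * (if S x then P (c' x) (column G x) else
  P b (column G x) * (if f c' G x != b then 1 / 2 else 1)).
rewrite (eq_bigr (fun c => \sum_G \prod_x F G x (c x))); last first.
  move=> c _; rewrite mulr_sumr; apply: eq_bigr => G _.
  rewrite pool_law_columns /hidden_errors f_mix.
  have -> : 2 ^- #|[pred x | ~~ S x && (f c' G x != mix S c' c x)]| =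
     \prod_x (if ~~ S x && (f c' G x != c x) then 1 / 2 else 1) :> R.
    rewrite -exprVn -prodr_const big_mkcond /=; apply: eq_bigr => x _.
    by rewrite inE ffunE; case: (S x) => //=; case: ifP; rewrite ?mul1r.
  rewrite -!big_split /=; apply: eq_bigr => x _; rewrite /F ffunE.
  by case: (S x) => /=; rewrite ?mulr1.
rewrite exchange_big /=.
rewrite (eq_bigr (fun G => \prod_x \sum_b F G x b)); last first.
  by move=> G _; rewrite bigA_distr_bigA.
(* Unlike [F], [psi] depends on the pool only through the column at [x], so that its product can be
   summed over [G]. *)
pose psi x v : R := if S x then P (c' x) v else
  1 / 2 * (P true v + P false v) - 1 / 4 * Num.min (P true v) (P false v).
have P0 b v : 0 <= P b v by exact: column_law_ge0.
apply: (@le_trans _ _ (\sum_G \prod_x psi x (column G x))).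
  apply: ler_sum => G _; apply: ler_prod => x _; rewrite big_bool /F /psi /=.
  have := P0 true (column G x); have := P0 false (column G x).
  have := P0 (c' x) (column G x).
  case: (S x) => //= H0; first by move=> _ _; apply/andP; split; lra.
  case: (f c' G x) => /= Hf Ht; apply/andP; split; try lra.
    have : Num.min (P true (column G x)) (P false (column G x)) <= P false (column G x).
      by rewrite ge_min lexx orbT.
    lra.
  have : Num.min (P true (column G x)) (P false (column G x)) <= P true (column G x).
    by rewrite ge_min lexx.
  lra.
rewrite sum_columns /B -prodr_const [leRHS]big_mkcond /= le_eqVlt; apply/orP; left.
apply/eqP; apply: eq_bigr => x _; rewrite inE /psi; case: (S x) => /=.
  exact: sum_column_law.
rewrite sumrB -!mulr_sumr big_split /= !sum_column_law /ov /overlap /P; lra.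
Qed.

Lemma few_hidden_errors (k : nat) :
  \sum_c concept_law c *
    \sum_(G | (hidden_errors c G <= k)%N) pool_law bias c G <=
  2 ^+ k * (1 - ov / 4) ^+ #|[pred x | ~~ S x]|.
Proof.
apply: le_trans (ler_wpM2l _ hidden_errors_laplace); last by rewrite exprn_ge0.
rewrite mulr_sumr; apply: ler_sum => c _; rewrite mulrCA.
apply: ler_wpM2l; first exact: concept_law_ge0.
rewrite mulr_sumr big_mkcond /=; apply: ler_sum => G _.
have G0 := pool_law_ge0 bias1 c G.
case: ifPn => [ek|_]; last by rewrite !mulr_ge0 ?invr_ge0 ?exprn_ge0.
rewrite mulrCA ler_peMr // ler_pdivlMr ?exprn_gt0 // mul1r.
by rewrite ler_weXn2l // ler1n.
Qed.

End HiddenPoints.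

(** * Simulating the protocol *)

Section SequenceFacts.
Variables (T U : Type) (s : seq T).

Lemma eq_map_onth (F F' : T -> U) :
  (forall i q, onth s i = Some q -> F q = F' q) -> map F s = map F' s.
Proof.
elim: s => //= q s' IH eqF; rewrite (eqF 0%N q) // IH // => i q' H.
exact: (eqF i.+1).
Qed.

Lemma hasPn_onth (a : pred T) i q : ~~ has a s -> onth s i = Some q -> ~~ a q.
Proof.
elim: s i => [|q' s' IH] [|i] //=; rewrite negb_or => /andP[aq' /IH]; last exact.
by move=> _ [<-].
Qed.

End SequenceFacts.

Section Responses.
Variables (R : realType) (X J : finType) (p : nat) (g : R).
Implicit Types (c h : {ffun X -> bool}) (G : pool X J p) (D : dist R X).

Definition candidates (k : nat) G : seq {ffun X -> bool} :=
  flatten [seq codom (G i) | i <- take k (enum 'I_p)].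

(** If no candidate passes, [nth] returns the fallback. The weak learner takes [k = p] and falls
    back on the concept; the simulation uses a constant, which reveals nothing. *)
Definition answer (k : nat) (fallback c : {ffun X -> bool}) G D : {ffun X -> bool} :=
  let s := candidates k G in nth fallback s (find (fun h => 2 * g <= corr D c h) s).

Lemma mem_take_enum_ord (k : nat) (i : 'I_p) :
  (i \in take k (enum 'I_p)) = (i < k)%N.
Proof.
rewrite -(mem_map val_inj) map_take val_enum_ord take_iota mem_iota.
by rewrite leq0n add0n leq_min ltn_ord andbT.
Qed.

Lemma eq_candidates k G G' : (forall i : 'I_p, (i < k)%N -> G i = G' i) ->
  candidates k G = candidates k G'.
Proof.
move=> eqG; congr flatten; apply/eq_in_map => i.
by rewrite mem_take_enum_ord => /eqG ->.
Qed.

(** The search follows batch order: once one of the first [k] batches has an answer, neither later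
    batches nor the fallback matter. *)
Lemma answer_prefix k fb fb' c G D (i : 'I_p) :
  (i < k)%N -> ~~ [forall j, corr D c (G i j) < 2 * g] ->
  answer k fb c G D = answer p fb' c G D.
Proof.
move=> ik /forallPn[j]; rewrite -leNgt => gj.
set a := fun h => 2 * g <= corr D c h.
have ha : has a (candidates k G).
  apply/hasP; exists (G i j) => //; apply/flattenP; exists (codom (G i)).
    by apply: map_f; rewrite mem_take_enum_ord.
  exact: codom_f.
have -> : answer p fb' c G D = nth fb' (candidates k G) (find a (candidates k G)).
  rewrite /answer /candidates take_oversize ?size_enum_ord //.
  rewrite -{1 2}(cat_take_drop k (enum 'I_p)) map_cat flatten_cat.
  by rewrite find_cat ha nth_cat -has_find ha.
by rewrite /answer; apply: set_nth_default; rewrite -has_find.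
Qed.

Lemma eq_answer k fb c c' G D :
  (forall x, D x != 0 -> c x = c' x) -> answer k fb c G D = answer k fb c' G D.
Proof.
move=> eqc; rewrite /answer (@eq_find _ _ (fun h => 2 * g <= corr D c' h)) // => h.
congr (_ <= _); apply: eq_bigr => x _.
by have [->|/eqc ->] := eqVneq (D x) 0; rewrite ?mul0r.
Qed.

Lemma answer_correct c G D : answer p c c G D = c \/
  (exists i j, answer p c c G D = G i j) /\ 2 * g <= corr D c (answer p c c G D).
Proof.
rewrite /answer; set a := fun h => _; set s := candidates p G.
have [has_a|no_a] := boolP (has a s); last first.
  by left; rewrite nth_default // leqNgt -has_find.
right; split; last exact: (nth_find c has_a).
have : nth c s (find a s) \in s by rewrite mem_nth // -has_find.
by move=> /flattenP[_ /mapP[i _ ->] /codomP[j ->]]; exists i, j.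
Qed.

End Responses.

Section Protocol.
Variables (R : realType) (X J : finType) (p t m : nat) (g : R).
Variables (A : learner R m X) (w : seed A) (S : m.-tuple X).
Hypothesis A_pt : parallel_complexity A p t.
Implicit Types (c : {ffun X -> bool}) (G : pool X J p).

Definition respond (k : nat) (fallback c : {ffun X -> bool}) G : responder R X :=
  fun _ _ D => answer g k fallback c G D.

(* The protocol in which round [i] is answered by the first [i + 1] batches
   only, without knowledge of the concept outside the support of the query. *)
Fixpoint sim_history c G (i : nat) : history R X :=
  if i is i'.+1
  then play_round c (respond i [ffun=> false] c G) w S (sim_history c G i')
  else [::].

Definition sim_queries c (i : 'I_p) G : seq (query R X) :=
  next_queries w (labeled c S) (sim_history c G i).

Definition sim_output c G : X -> bool :=
  final w (labeled c S) (sim_history c G p).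

Definition unanswered c (q : query R X) (a : batch X J) : bool :=
  [forall j, corr (qdist q) c (a j) < 2 * g].

(** The hypothesis concerns the simulated queries, to which the union bound applies; inductively
    both histories agree, so these are also the actual queries. *)
Lemma output_sim c G :
  ~~ [exists i, has ((unanswered c)^~ (G i)) (sim_queries c i G)] ->
  output c (respond p c c G) w S = sim_output c G.
Proof.
move=> /existsPn ans; rewrite /output A_pt.1 /sim_output.
suff H k : (k <= p)%N ->
    iter k (play_round c (respond p c c G) w S) [::] = sim_history c G k.
  by rewrite H.
elim: k => //= k IH kp; rewrite IH 1?ltnW // /play_round; congr rcons.
apply: eq_map_onth => i q qi; congr (_, _); rewrite /respond.
have := hasPn_onth (ans (Ordinal kp)) qi.
have ik : (Ordinal kp < k.+1)%N by exact: ltnSn.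
by move=> H; rewrite (answer_prefix [ffun=> false] c ik H).
Qed.

Lemma eq_labeled (c c' : classifier X) : {in S, c =1 c'} -> labeled c S = labeled c' S.
Proof. by move=> eqc; apply: eq_from_tnth => i; rewrite !tnth_mktuple eqc ?mem_tnth. Qed.

(** Simulated answers read the concept only on the support of the query, which parallel complexity
    confines to the sample. *)
Lemma eq_sim_history c c' G k : {in S, c =1 c'} ->
  sim_history c G k = sim_history c' G k.
Proof.
move=> eqc; elim: k => //= k ->; rewrite /play_round (eq_labeled eqc); congr rcons.
apply: eq_map_onth => i q qi; congr (_, _).
have [qS qD] := (A_pt.2 w _ _).2 i q qi.
apply/(congr1 (fun h : {ffun X -> bool} => h : X -> bool)).
apply: eq_answer => x Dx; apply: eqc.
have /mapP[[y b] /tnthP[l]] := qS _ (qD _ Dx).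
by rewrite tnth_mktuple => -[-> _] ->; exact: mem_tnth.
Qed.

Lemma sim_output_mix c c' G :
  sim_output (mix [in S] c' c) G = sim_output c' G.
Proof.
have eqc : {in S, mix [in S] c' c =1 c'} by move=> x xS; rewrite ffunE /= xS.
by rewrite /sim_output (eq_labeled eqc) (eq_sim_history _ _ eqc).
Qed.

(** A history of length [k] involves only batches of index below [k], which for [k <= i] are not
    resampled. *)
Lemma sim_queries_mix c (i : 'I_p) G' G :
  sim_queries c i (mix (fun k : 'I_p => (k < i)%N) G' G) = sim_queries c i G'.
Proof.
rewrite /sim_queries; congr (next_queries _ _ _).
suff H k : (k <= i)%N -> sim_history c (mix (fun k : 'I_p => (k < i)%N) G' G) k =
    sim_history c G' k by rewrite H.
elim: k => //= k IH ki.
rewrite IH 1?ltnW // /play_round /respond /answer.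
rewrite (@eq_candidates _ _ _ _ _ G') // => l lk.
by rewrite ffunE (leq_trans lk ki).
Qed.

Lemma size_sim_queries c i G : (size (sim_queries c i G) <= t)%N.
Proof. by have [] := A_pt.2 w (labeled c S) (sim_history c G i). Qed.

End Protocol.

(** * The weak learner and its hypothesis class *)

Section FiniteDomain.
Variables (R : realType) (X : finType).
Implicit Types (c h : {ffun X -> bool}) (D : dist R X).

Lemma esum_finType (T : finType) (P : pred T) (a : T -> \bar R) :
  (forall x, P x -> (0 <= a x)%E) ->
  (\esum_(x in [set x | P x]) a x = \sum_(x | P x) a x)%E.
Proof.
move=> a0; rewrite esum_fset; last by move=> x /set_mem /a0.
  rewrite (bigfs _ (index_enum_uniq T)) // => x _.
  by rewrite mem_index_enum.
exact: finite_finset.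
Qed.

Lemma esum_finTypeT (T : finType) (a : T -> \bar R) :
  (forall x, (0 <= a x)%E) -> (\esum_(x in [set: T]) a x = \sum_x a x)%E.
Proof.
move=> a0; rewrite -(@esum_finType T xpredT) //; congr esum.
by apply/seteqP; split.
Qed.

Lemma dist_sum1 D : \sum_x D x = 1.
Proof.
have := mass_sum1 D; rewrite esum_finTypeT.
  by rewrite sumEFin => -[].
by move=> x; rewrite lee_fin mass_ge0.
Qed.

Lemma loss_fin D (c h : classifier X) : loss D c h = (\sum_(x | h x != c x) D x)%:E.
Proof.
rewrite /loss (esum_finType (P := fun x => h x != c x)) ?sumEFin //.
by move=> x _; rewrite lee_fin mass_ge0.
Qed.

Lemma corr_loss D c h : corr D c h = 1 - 2 * \sum_(x | h x != c x) D x.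
Proof.
rewrite -[X in _ = X - _](dist_sum1 D) mulr_sumr [X in _ - X]big_mkcond /= -sumrB.
apply: eq_bigr => x _; rewrite /sign; case: eqP => _ /=; lra.
Qed.

Lemma uniform_sum1 (x0 : X) :
  (\esum_(x in [set: X]) (#|X|%:R^-1 : R)%:E = 1)%E.
Proof.
rewrite esum_finTypeT; last by move=> x; rewrite lee_fin invr_ge0.
rewrite sumEFin sumr_const -[_ *+ _]mulr_natl mulfV //.
by rewrite pnatr_eq0 -lt0n; apply/card_gt0P; exists x0.
Qed.

Lemma uniform_ge0 (x : X) : (0 : R) <= #|X|%:R^-1.
Proof. by rewrite invr_ge0. Qed.

Definition uniform_dist (x0 : X) : dist R X := Dist uniform_ge0 (uniform_sum1 x0).

End FiniteDomain.

(* [dist R X] is empty when [X] is, while the library only knows measurable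
   spaces with a distinguished point. *)
Definition pointed_dist (R : realType) (X : finType) (x0 : X) : Type := dist R X.

HB.instance Definition _ (R : realType) (X : finType) (x0 : X) :=
  gen_eqMixin (pointed_dist R x0).
HB.instance Definition _ (R : realType) (X : finType) (x0 : X) :=
  gen_choiceMixin (pointed_dist R x0).
HB.instance Definition _ (R : realType) (X : finType) (x0 : X) :=
  isPointed.Build (pointed_dist R x0) (uniform_dist R x0).

Section MeasurableResponse.
Variables (R : realType) (X : finType) (x0 : X).

Let distM := g_sigma_algebraType
  (@mass_cylinders R X : set (set (pointed_dist R x0))).

Lemma measurable_mass (x : X) :
  measurable_fun setT (fun D : distM => (D : dist R X) x).
Proof.
move=> _ B mB; rewrite setTI; apply: sub_sigma_algebra.
by exists x, B.
Qed.

Lemma measurable_corr (c h : {ffun X -> bool}) :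
  measurable_fun setT (fun D : distM => corr (D : dist R X) c h).
Proof.
apply: measurable_sum => x; apply: measurable_funM; last exact: measurable_cst.
exact: measurable_mass.
Qed.

(** The response is a decision list whose tests are half-line conditions on finite combinations of
    masses. *)
Lemma measurable_respond (J : finType) (p k : nat) (g : R)
    (fb c : {ffun X -> bool}) (G : pool X J p) :
  measurable_responder (respond g k fb c G).
Proof.
move=> s y x; rewrite /respond /answer /=.
suff : measurable [set D : distM | nth fb (candidates k G)
    (find (fun h => 2 * g <= corr (D : dist R X) c h) (candidates k G)) x] by [].
elim: (candidates k G) => [|h s' IH] /=.
  by case: (fb x); [rewrite (_ : [set _ | _] = setT) | rewrite (_ : [set _ | _] = set0)];
    rewrite //; apply/seteqP; split.
pose E := [set D : distM | 2 * g <= corr (D : dist R X) c h].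
have mE : measurable E.
  rewrite (_ : E = setT `&` (fun D : distM => corr (D : dist R X) c h) @^-1` `[2 * g, +oo[).
    exact: measurable_corr.
  by apply/seteqP; split => D; rewrite /E /= in_itv /= andbT //; case.
have mh : measurable [set _ : distM | h x].
  by case: (h x); [rewrite (_ : [set _ | _] = setT) | rewrite (_ : [set _ | _] = set0)];
    rewrite //; apply/seteqP; split.
rewrite (_ : [set _ | _] = (E `&` [set _ | h x]) `|` (~` E `&` [set D : distM | nth fb s'
    (find (fun h => 2 * g <= corr (D : dist R X) c h) s') x])).
  by apply: measurableU; apply: measurableI => //; exact: measurableC.
apply/seteqP; split => D; rewrite /E /=.
  by case: ifP => _ /= ?; [left | right].
by case: ifP => _ /=; case; case.
Qed.

End MeasurableResponse.

Section HypothesisClass.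
Variables (X : finType) (d : nat).
Implicit Type F : seq {ffun X -> bool}.

(* The functions vanishing outside [d] fixed points raise the VC-dimension to
   [d]; a larger shattered set would need [2 ^ d] further functions. *)
Definition padded_class F : set (classifier X) :=
  [set h : classifier X | (exists2 f : {ffun X -> bool}, f \in F & h = f) \/
           (forall x, x \notin take d (enum X) -> h x = false)].

Lemma padded_class_VC F : (d <= #|X|)%N -> (size F < 2 ^ d)%N ->
  has_VC_dim (padded_class F) d.
Proof.
move=> dX szF; have szZ : size (take d (enum X)) = d.
  by rewrite size_takel // -cardE.
split.
  exists (take d (enum X)); split => //; first by rewrite take_uniq ?enum_uniq.
  move=> b; exists (fun x => (x \in take d (enum X)) && b x).
    by right => x /negbTE ->.
  by move=> x ->.
move=> s us shat; rewrite leqNgt; apply/negP => ds.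
(* Padding functions vanish at [x], so the patterns on [s] that are true at [x] all come from [F];
   they restrict to every subset of [s'], hence number at least [2 ^ d]. *)
have [x xs xZ] : exists2 x, x \in s & x \notin take d (enum X).
  apply/hasP; rewrite -[has _ _]negbK -all_predC; apply/negP => /allP sZ.
  have : (size s <= size (take d (enum X)))%N.
    by apply: uniq_leq_size => // y /sZ /=; rewrite negbK.
  by rewrite szZ leqNgt ds.
pose s' := [set y in s | y != x]%SET.
pose phi (f : {ffun X -> bool}) := [set y in s' | f y]%SET.
have : (size (enum (powerset s')) <= size (map phi F))%N.
  apply: uniq_leq_size (enum_uniq _) _ => T; rewrite mem_enum powersetE => Ts.
  have [h Hh hs] := shat (fun y => (y == x) || (y \in T)).
  case: Hh => [[f fF hf]|Hz]; last first.
    by have := hs x xs; rewrite Hz // eqxx.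
  apply/mapP; exists f => //; apply/setP => y; rewrite inE.
  apply/idP/andP => [yT|[ys fy]].
    have ys := fintype.subsetP Ts y yT; split => //.
    by have := hs y; rewrite hf => ->; [rewrite yT orbT | move: ys; rewrite inE => /andP[]].
  move: ys; rewrite inE => /andP[ys yx].
  by have := hs y ys; rewrite hf fy (negbTE yx).
rewrite -cardE card_powerset size_map leqNgt; apply/negP/negPn.
apply: leq_trans szF _; rewrite leq_exp2l //.
suff : #|s'| = (size s).-1 by case: (size s) ds => //= n; rewrite ltnS => dn ->.
rewrite -(card_uniqP us) [in RHS](cardD1 x) xs /=; apply: eq_card => y.
by rewrite !inE andbC.
Qed.

Lemma padded_class_weak_learner (R : realType) (J : finType) (p : nat) (g : R)
    (c : {ffun X -> bool}) (G : pool X J p) F :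
  2 * g <= 1 -> c \in F -> (forall i j, G i j \in F) ->
  weak_learner g c (padded_class F) (respond g p c c G).
Proof.
move=> g1 cF GF s D _; rewrite /respond; split.
  left; have [->|[[i [j ->]] _]] := answer_correct g c G D; first by exists c.
  by exists (G i j).
rewrite loss_fin lee_fin; have [->|[_]] := answer_correct g c G D.
  by rewrite big_pred0 => [|x]; rewrite ?eqxx //; lra.
by rewrite corr_loss; lra.
Qed.

End HypothesisClass.

(** * Averaging over concepts and pools *)

Section Averaging.
Variables (R : realType) (X : finType) (m : nat) (A : learner R m X) (D : dist R X).

Lemma sum_sample_law :
  \sum_(S : m.-tuple X) \prod_(i < m) D (tnth S i) = 1.
Proof.
transitivity (\sum_(f : {ffun 'I_m -> X}) \prod_i D (f i)).
  rewrite (reindex (fun f : {ffun 'I_m -> X} => [tuple f i | i < m])) /=.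
    by apply: eq_bigr => f _; apply: eq_bigr => i _; rewrite tnth_mktuple.
  exists (fun S => [ffun i => tnth S i]) => [f|S] _.
    by apply/ffunP => i; rewrite ffunE tnth_mktuple.
  by apply: eq_from_tnth => i; rewrite tnth_mktuple ffunE.
by rewrite -(bigA_distr_bigA (fun _ => D)) big1 // => i _; exact: dist_sum1.
Qed.

Definition error (c h : classifier X) : R := \sum_(x | h x != c x) D x.

Lemma error_ge0 c h : 0 <= error c h.
Proof. by apply: sumr_ge0 => x _; exact: mass_ge0. Qed.

Lemma error_le1 c h : error c h <= 1.
Proof.
rewrite -(dist_sum1 D) [leRHS](bigID (fun x => h x != c x)) /= lerDl.
by apply: sumr_ge0 => x _; exact: mass_ge0.
Qed.

Hypothesis mA : measurable_learner A.

Lemma measurable_error c W (S : m.-tuple X) : measurable_responder W ->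
  measurable_fun setT (fun w : seed A => error c (output c W w S)).
Proof.
move=> mW.
rewrite (_ : (fun _ => _) = (fun w : seed A => \sum_x
    (if output c W w S x then (if true != c x then D x else 0)
     else (if false != c x then D x else 0)))); last first.
  apply/funext => w; rewrite /error big_mkcond; apply: eq_bigr => x _.
  by case: (output _ _ _ _ x).
apply: measurable_sum => x; apply: measurable_fun_ifT; try exact: measurable_cst.
apply: (measurable_fun_bool true); rewrite setTI.
exact: mA.
Qed.

(** If every outcome had expected loss at most [r], so would their average. Exchanging the averages
    leaves a lower bound at fixed seed and sample, with only the outcome random. *)
Lemma averaging (Omega : finType) (law : Omega -> R) (c : Omega -> classifier X)
    (W : Omega -> responder R X) (rho r : R) :
  (forall o, 0 <= law o) -> \sum_o law o = 1 ->
  (forall o, measurable_responder (W o)) ->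
  (forall (w : seed A) (S : m.-tuple X),
     rho <= \sum_o law o * error (c o) (output (c o) (W o) w S)) ->
  (forall o, (expected_loss A D (c o) (W o) <= r%:E)%E) ->
  rho <= r.
Proof.
move=> law0 law1 mW rhoP Er.
have mE o (S : m.-tuple X) : measurable_fun setT
    (EFin \o (fun w : seed A => error (c o) (output (c o) (W o) w S))).
  by apply/measurable_EFinP; exact: measurable_error.
pose I o (S : m.-tuple X) : \bar R := (\int[seed_law A]_(w in [set: seed A])
  (error (c o) (output (c o) (W o) w S))%:E)%E.
have I0 o S : (0 <= I o S)%E.
  by apply: integral_ge0 => w _; rewrite lee_fin error_ge0.
have I1 o S : (I o S <= 1)%E.
  apply: (@le_trans _ _ (\int[seed_law A]_(w in [set: seed A]) cst 1%:E w)%E).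
    apply: ge0_le_integral.
    - exact: measurableT.
    - by move=> w _; rewrite lee_fin error_ge0.
    - exact: mE.
    - exact: measurable_cst.
    - by move=> w _; rewrite lee_fin error_le1.
  by rewrite integral_cst // [X in (_ * X)%E](@probability_setT _ _ _ (seed_law A)) mule1.
have IE o S : I o S = (fine (I o S))%:E.
  rewrite fineK // ge0_fin_numE //; exact: le_lt_trans (I1 o S) (ltry _).
pose pr (S : m.-tuple X) : R := \prod_(i < m) D (tnth S i).
have pr0 S : 0 <= pr S by apply: prodr_ge0 => i _; exact: mass_ge0.
have EE o : \sum_S pr S * fine (I o S) <= r.
  rewrite -lee_fin; apply: le_trans (Er o); rewrite /expected_loss.
  rewrite (@esum_finTypeT R (m.-tuple X)); last first.
    move=> S; apply: mule_ge0; first by rewrite lee_fin pr0.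
    by apply: integral_ge0 => w _; rewrite loss_fin lee_fin error_ge0.
  rewrite -sumEFin le_eqVlt; apply/orP; left; apply/eqP; apply: eq_bigr => S _.
  rewrite EFinM -IE; congr (_ * _)%E; apply: eq_integral => w _.
  by rewrite loss_fin.
have rhoS S : rho <= \sum_o law o * fine (I o S).
  rewrite -lee_fin -sumEFin.
  have -> : (\sum_o (law o * fine (I o S))%:E =
      \int[seed_law A]_(w in [set: seed A])
        \sum_o (law o)%:E * (error (c o) (output (c o) (W o) w S))%:E)%E.
    rewrite ge0_integral_sum //; last 2 first.
    - by move=> o; apply: emeasurable_funM; [exact: measurable_cst|exact: mE].
    - by move=> o w _; rewrite mule_ge0 ?lee_fin ?error_ge0.
    apply: eq_bigr => o _; rewrite ge0_integralZl_EFin //.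
    - by rewrite EFinM -IE.
    - by move=> w _; rewrite lee_fin error_ge0.
    - exact: mE.
  apply: (@le_trans _ _ (\int[seed_law A]_(w in [set: seed A]) cst (rho%:E) w)%E).
    by rewrite integral_cst // [X in (_ * X)%E](@probability_setT _ _ _ (seed_law A)) mule1.
  have [rho0|rho0] := leP 0 rho.
    apply: ge0_le_integral.
    - exact: measurableT.
    - by move=> w _; rewrite lee_fin.
    - exact: measurable_cst.
    - apply: emeasurable_sum => o; apply: emeasurable_funM; [exact: measurable_cst|exact: mE].
    - by move=> w _; under eq_bigr do rewrite -EFinM; rewrite sumEFin lee_fin.
  rewrite integral_cst // [X in (_ * X)%E](@probability_setT _ _ _ (seed_law A)) mule1.
  apply: (@le_trans _ _ 0%E); first by rewrite lee_fin ltW.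
  by apply: integral_ge0 => w _; apply: sume_ge0 => o _; rewrite mule_ge0 ?lee_fin ?error_ge0.
apply: (@le_trans _ _ (\sum_S pr S * \sum_o law o * fine (I o S))).
  rewrite -[rho]mul1r -sum_sample_law mulr_suml; apply: ler_sum => S _.
  by apply: (ler_wpM2l (pr0 S)); exact: rhoS.
rewrite (eq_bigr (fun S => \sum_o law o * (pr S * fine (I o S)))); last first.
  by move=> S _; rewrite mulr_sumr; apply: eq_bigr => o _; rewrite mulrCA.
rewrite exchange_big /= -[r]mul1r -law1 mulr_suml; apply: ler_sum => o _.
by rewrite -mulr_sumr; apply: (ler_wpM2l (law0 o)); exact: EE.
Qed.

End Averaging.

Section SimulatedLoss.
Variables (R : realType) (X J : finType) (p t m : nat) (g b : R) (bias : J -> R).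
Variables (A : learner R m X) (x0 : X).
Hypothesis A_pt : parallel_complexity A p t.
Hypothesis bias1 : forall j, `|bias j| <= 1.
Hypothesis b0 : 0 <= b.
Hypothesis unansweredP : forall (c : {ffun X -> bool}) (D : dist R X),
  \sum_(a : batch X J | [forall j, corr D c (a j) < 2 * g]) batch_law bias c a <= b.
Hypothesis ptb : p%:R * t%:R * b <= 1 / 2.

Let ov := overlap (column_bias (p := p) bias).

(** Some query is unanswered with probability at most 1/2, and hidden errors are few with
    probability at most 1/4. Otherwise the output is the simulated one and errs on a fraction at
    least [ov / 16] of the domain. *)
Lemma mean_error_ge (w : seed A) (S : m.-tuple X) :
  (2 * m <= #|X|)%N -> 32 <= ov * #|X|%:R ->
  ov / 64 <= \sum_(o : {ffun X -> bool} * pool X J p)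
    concept_law R o.1 * pool_law bias o.1 o.2 *
    error (uniform_dist R x0) o.1 (output o.1 (respond g p o.1 o.1 o.2) w S).
Proof.
move=> mX ovX.
have ov1 : ov <= 1 := overlap_le1 _.
have ov0 : 0 <= ov.
  apply: sumr_ge0 => v _; rewrite le_min !column_law_ge0 // => k; exact: bias1.
pose f (c : {ffun X -> bool}) (G : pool X J p) := sim_output g w S c G.
have f_mix (c' c : {ffun X -> bool}) (G : pool X J p) : f (mix [in S] c' c) G = f c' G.
  by exact: sim_output_mix A_pt _ _ _.
have NX : #|X|%:R <= 2 * #|[pred x | x \notin S]|%:R :> R.
  rewrite -natrM ler_nat.
  have := cardC [in S]; have := card_size S; rewrite size_tuple.
  set s1 := #|_|; have -> : #|[predC S]| = #|[pred x | x \notin S]| by apply: eq_card.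
  by lia.
set N := #|[pred x | x \notin S]| in NX.
(* As [2 ^+ k <= expR k], at most [k] errors occur with probability at most
   [expR (ov * N / 8 - ov * N / 4)], and [16 <= ov * N]. *)
pose k := Num.truncn (ov * N%:R / 8).
have /andP[k1 k2] : k%:R <= ov * N%:R / 8 < k.+1%:R.
  by apply: truncn_itv; rewrite divr_ge0 ?mulr_ge0.
have ovN : 16 <= ov * N%:R by have : ov * #|X|%:R <= ov * (2 * N%:R) := ler_wpM2l ov0 NX; lra.
have ovk : ov / 16 * #|X|%:R <= k.+1%:R.
  by have : ov * #|X|%:R <= ov * (2 * N%:R) := ler_wpM2l ov0 NX; lra.
have e2 : 2 <= expR 1 :> R by have := expR_ge1Dx (1 : R); lra.
have few : 2 ^+ k * (1 - ov / 4) ^+ N <= 1 / 4.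
  apply: (@le_trans _ _ (expR k%:R * expR (- (ov / 4 * N%:R)))).
    apply: ler_pM; rewrite ?exprn_ge0 //; first by lra.
      by rewrite -[k%:R]mulr1 expRM_natl lerXn2r ?nnegrE // expR_ge0.
    rewrite -[in leRHS]mulNr expRM_natr lerXn2r ?nnegrE ?expR_ge0 //; first by lra.
    by have := expR_ge1Dx (- (ov / 4)); lra.
  rewrite -expRD; apply: le_trans (expR_opp2 R); rewrite ler_expR; lra.
pose law (o : {ffun X -> bool} * pool X J p) := concept_law R o.1 * pool_law bias o.1 o.2.
have law0 o : 0 <= law o.
  by rewrite mulr_ge0 ?concept_law_ge0 // pool_law_ge0.
pose bad (o : {ffun X -> bool} * pool X J p) :=
  [exists i, has (fun q => unanswered g o.1 q (o.2 i)) (sim_queries g w S o.1 i o.2)].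
pose quiet (o : {ffun X -> bool} * pool X J p) := (hidden_errors [in S] f o.1 o.2 <= k)%N.
have law1 : \sum_o law o = 1.
  rewrite -(pair_bigA _ (fun c G => concept_law R c * pool_law bias c G)) /=.
  rewrite -[RHS](sum_concept_law R X); apply: eq_bigr => c _.
  by rewrite -mulr_sumr sum_pool_law mulr1.
have law_quiet : \sum_(o | quiet o) law o <= 1 / 4.
  rewrite big_mkcond /= -(pair_bigA _ (fun c G => if quiet (c, G) then law (c, G) else 0)).
  apply: le_trans few; apply: le_trans (few_hidden_errors bias1 f_mix k).
  apply: ler_sum => c _; rewrite mulr_sumr [leRHS]big_mkcond /=.
  by apply: ler_sum => G _.
have law_bad : \sum_(o | bad o) law o <= 1 / 2.
  rewrite big_mkcond /= -(pair_bigA _ (fun c G => if bad (c, G) then law (c, G) else 0)).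
  apply: le_trans ptb; set B := (X in _ <= X).
  have -> : B = (\sum_(c : {ffun X -> bool}) concept_law R c) * B
    by rewrite sum_concept_law mul1r.
  rewrite mulr_suml.
  apply: ler_sum => c _.
  apply: (@le_trans _ _ (concept_law R c * \sum_(G | bad (c, G)) pool_law bias c G)).
    by rewrite mulr_sumr [leRHS]big_mkcond /=; apply: ler_sum.
  apply: ler_wpM2l; first exact: concept_law_ge0.
  exact: (@adaptive_union_bound R X J p bias bias1 _ c (unanswered g c)
    (sim_queries g w S c) t b b0 (fun q => unansweredP c (qdist q))
    (size_sim_queries g w S A_pt c) (sim_queries_mix g w S c)).
have X0 : 0 < #|X|%:R :> R by rewrite ltr0n; apply/card_gt0P; exists x0.
apply: (@le_trans _ _ (\sum_(o | ~~ bad o && ~~ quiet o) law o * (ov / 16))).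
  rewrite -mulr_suml.
  have : 1 / 4 <= \sum_(o | ~~ bad o && ~~ quiet o) law o.
    have : \sum_o law o <= \sum_(o | bad o) law o + \sum_(o | quiet o) law o +
        \sum_(o | ~~ bad o && ~~ quiet o) law o.
      rewrite [X in X + _ + _]big_mkcond [X in _ + X + _]big_mkcond.
      rewrite [X in _ + X]big_mkcond -!big_split /=; apply: ler_sum => o _.
      by have := law0 o; case: (bad o); case: (quiet o) => /= ?;
        rewrite ?addr0 ?add0r ?lerDl.
    by move: law_quiet law_bad; rewrite law1; clear; lra.
  have ov16 : 0 <= ov / 16 by rewrite divr_ge0.
  move=> /(ler_wpM2r ov16); apply: le_trans.
  by rewrite (_ : 1 / 4 * (ov / 16) = ov / 64) //; field.
rewrite big_mkcond /=; apply: ler_sum => -[c G] _.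
case: ifPn => [/andP[nbad nquiet]|_]; last first.
  by rewrite mulr_ge0 ?error_ge0 //; exact: law0.
apply: ler_wpM2l; first exact: law0.
rewrite /error /= sumr_const (output_sim A_pt nbad) -[leRHS]mulr_natl.
rewrite ler_pdivlMr //.
apply: (le_trans ovk).
rewrite ler_nat; move: nquiet; rewrite /quiet -ltnNge => /leq_trans; apply.
apply: subset_leq_card; apply/fintype.subsetP => x; rewrite !inE.
by case/andP.
Qed.

End SimulatedLoss.

(** * Choice of the parameters *)

Section Constants.
Variable R : realType.
Implicit Types (g : R) (d m p t th : nat).

Lemma expR1_le4 : expR 1 <= 4 :> R.
Proof.
have h : expR (1 / 3) <= 3 / 2 :> R by have := @expR_le_quad R (1 / 3); lra.
have -> : expR 1 = expR (1 / 3) ^+ 3 :> R by rewrite -expRM_natl; congr expR; lra.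
apply: (@le_trans _ _ ((3 / 2) ^+ 3)); last by lra.
by rewrite lerXn2r ?nnegrE ?expR_ge0 //; lra.
Qed.

Lemma natr_le_expR_ln t : t%:R <= expR (ln t%:R) :> R.
Proof.
by case: t => [|t]; [exact: expR_ge0 | rewrite lnK // posrE ltr0n].
Qed.

Lemma ln_natr_ge0 t : 0 <= ln t%:R :> R.
Proof.
by case: t => [|t]; [rewrite ln0 | rewrite ln_ge0 // ler1n].
Qed.

(** The [+ 4] yields [th * r >= ln t + 3 * th], enough to beat the [p * t <= expR (th + ln t)]
    queries with a factor 1/4 to spare. *)
Definition biased_count (th t : nat) : nat := (Num.truncn (ln t%:R / th%:R : R) + 4)%N.

(** Multiplied by the success probability [expR (- (38 * th))], this is at least [expR (2 * th)],
    which beats [th + ln t + 2] when [ln t <= expR th]. *)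
Definition uniform_count th : nat := (Num.truncn (expR (40 * th%:R) : R)).+1.

Definition round_failure_bound th r l : R :=
  expR (- (th * r)%:R) + expR (- (expR (- (38 * th%:R)) * l%:R)).

Lemma biased_count_bounds th t : (2 <= th)%N ->
  ln t%:R + 3 * th%:R <= (th * biased_count th t)%:R :> R /\
  (biased_count th t)%:R <= ln t%:R / th%:R + 4 :> R.
Proof.
move=> th2; have thR : 2 <= th%:R :> R by rewrite (ler_nat R 2).
have x0 : 0 <= ln t%:R / th%:R :> R by rewrite divr_ge0 // ln_natr_ge0.
have := truncn_itv x0; rewrite /biased_count natrM natrD.
set n := Num.truncn _; rewrite -[n.+1]addn1 natrD => /andP[n1 n2]; split; last by lra.
move: n2; rewrite ltr_pdivrMr; last by lra.
by lra.
Qed.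

Lemma uniform_count_bounds th :
  expR (40 * th%:R) <= (uniform_count th)%:R :> R /\
  (uniform_count th)%:R <= expR (40 * th%:R) + 1 :> R.
Proof.
have := truncn_itv (expR_ge0 (40 * th%:R : R)); rewrite /uniform_count.
by set n := Num.truncn _; rewrite -[n.+1]addn1 natrD => /andP[n1 n2]; lra.
Qed.

Lemma union_bound_small th p t : (2 <= th)%N ->
  p%:R <= expR th%:R :> R -> ln t%:R <= expR th%:R :> R ->
  p%:R * t%:R *
    round_failure_bound th (biased_count th t) (uniform_count th) <= 1 / 2.
Proof.
move=> th2 pth tth; have thR : 2 <= th%:R :> R by rewrite (ler_nat R 2).
have pt : p%:R * t%:R <= expR (th%:R + ln t%:R) :> R.
  by rewrite expRD ler_pM // natr_le_expR_ln.
have [r1 _] := biased_count_bounds t th2; have [l1 _] := uniform_count_bounds th.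
have small (y : R) : th%:R + ln t%:R + 2 <= y -> p%:R * t%:R * expR (- y) <= 1 / 4.
  move=> ty; apply: le_trans (expR_opp2 R).
  apply: (@le_trans _ _ (expR (th%:R + ln t%:R) * expR (- y))).
    by rewrite ler_wpM2r // expR_ge0.
  by rewrite -expRD ler_expR; lra.
rewrite /round_failure_bound mulrDr.
have := small _ (_ : _ <= (th * biased_count th t)%:R).
have := small _ (_ : _ <= expR (- (38 * th%:R)) * (uniform_count th)%:R).
have -> : th%:R + ln t%:R + 2 <= (th * biased_count th t)%:R :> R by lra.
have -> : th%:R + ln t%:R + 2 <= expR (- (38 * th%:R)) * (uniform_count th)%:R :> R.
  apply: (@le_trans _ _ (expR (- (38 * th%:R)) * expR (40 * th%:R))); last first.
    by rewrite ler_wpM2l // expR_ge0.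
  rewrite -expRD (_ : - (38 * th%:R) + _ = th%:R + th%:R); last by lra.
  have := expR_ge1Dx (th%:R : R); rewrite expRD; move: tth.
  by move: (expR _) => z; nra.
by move=> /(_ isT) h1 /(_ isT) h2; lra.
Qed.

(** The successor counts the concept itself. The total is at most [expR (42 * th) <= 2 ^ (84 * th)],
    whence the room left by [100 * th <= d]. *)
Lemma pool_size_small th d p t : (2 <= th)%N -> (100 * th <= d)%N ->
  p%:R <= expR th%:R :> R -> ln t%:R <= expR th%:R :> R ->
  ((p * (biased_count th t + uniform_count th)).+1 < 2 ^ d)%N.
Proof.
move=> th2 thd pth tth; have thR : 2 <= th%:R :> R by rewrite (ler_nat R 2).
have [_ r1] := biased_count_bounds t th2; have [_ l1] := uniform_count_bounds th.
rewrite -(ltr_nat R) -[(p * _).+1]addn1 natrD natrM natrD natrX.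
set z := expR th%:R in pth tth.
have z3 : 3 <= z by have := expR_ge1Dx (th%:R : R); rewrite -/z; lra.
have z40 : expR (40 * th%:R) = z ^+ 40 :> R by rewrite expRM_natl.
have r2 : (biased_count th t)%:R <= z + 4.
  apply: le_trans r1 _; rewrite lerD2r ler_pdivrMr; last by lra.
  by apply: le_trans tth _; rewrite ler_peMr; lra.
have z4 : z <= 4 ^+ th.
  by rewrite /z -[th%:R]mulr1 expRM_natl lerXn2r ?nnegrE ?expR_ge0 // expR1_le4.
have zz : z + 5 <= z ^+ 40.
  apply: (@le_trans _ _ (z ^+ 2)); first by rewrite expr2; nra.
  by rewrite ler_weXn2l //; lra.
have z41 : 1 <= z ^+ 41 by rewrite exprn_ege1 //; lra.
have : p%:R * ((biased_count th t)%:R + (uniform_count th)%:R) + 1 <= z ^+ 42.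
  have : p%:R * ((biased_count th t)%:R + (uniform_count th)%:R) <= z * (2 * z ^+ 40).
    by apply: ler_pM => //; rewrite ?addr_ge0 //; move: l1; rewrite z40; lra.
  have -> : z * (2 * z ^+ 40) = 2 * z ^+ 41 by rewrite mulrCA -exprS.
  have : 3 * z ^+ 41 <= z ^+ 42 by rewrite [z ^+ 42]exprS ler_wpM2r //; lra.
  by lra.
move/le_lt_trans; apply.
apply: (@le_lt_trans _ _ (2 ^+ (84 * th))); last first.
  by rewrite ltr_eXn2l ?ltr1n //; clear -th2 thd; lia.
apply: (@le_trans _ _ ((4 ^+ th) ^+ 42)).
  by rewrite lerXn2r ?nnegrE ?exprn_ge0 //; lra.
have -> : 4 = 2 ^+ 2 :> R by rewrite expr2; lra.
by rewrite -!exprM ler_weXn2l ?ler1n //; clear; lia.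
Qed.

Definition sum_bias g r l (j : 'I_r + 'I_l) : R :=
  if j is inl _ then 12 * g else 0.

Lemma sum_bias_le1 g r l (j : 'I_r + 'I_l) :
  0 < g -> g <= 1 / 20 -> `|sum_bias g j| <= 1.
Proof.
by move=> g0 g1; case: j => i /=; rewrite ?normr0 // ger0_norm; lra.
Qed.

(** Uniform functions contribute a factor 1 to [overlap_ge]; for the [p * r] biased ones,
    [1 - u >= expR (- (2 * u))] with [u = (12 * g) ^+ 2 <= 1 / 2]. *)
Lemma overlap_ge_expR g r l p : 0 < g -> g <= 1 / 20 ->
  expR (- (288 * g ^+ 2 * (p * r)%:R)) / 2 <=
  overlap (column_bias (p := p) (@sum_bias g r l)).
Proof.
move=> g0 g1; apply: le_trans (overlap_ge _); last first.
  by move=> k; exact: sum_bias_le1.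
rewrite ler_wpM2r //.
rewrite -(pair_bigA _ (fun (i : 'I_p) j => 1 - sum_bias g j ^+ 2)) /=.
rewrite big_sumType /= !prodr_const !card_ord expr0n subr0 expr1n mulr1.
rewrite -exprM mulnC -mulNr expRM_natr lerXn2r ?nnegrE ?expR_ge0 //.
  by rewrite exprMn; nra.
have u0 : 0 <= (12 * g) ^+ 2 by exact: sqr_ge0.
have u1 : (12 * g) ^+ 2 <= 1 / 2 by rewrite exprMn; nra.
rewrite (_ : 288 * g ^+ 2 = 2 * (12 * g) ^+ 2); last by rewrite exprMn; lra.
move: ((12 * g) ^+ 2) u0 u1 => u u0 u1.
have h := expR_ge1Dx (2 * u); have e : expR (- (2 * u)) * expR (2 * u) = 1.
  by rewrite -expRD addNr expR0.
have := expR_gt0 (- (2 * u)); move: (expR (- (2 * u))) (expR (2 * u)) h e => y z h e y0.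
have := ler_wpM2l (ltW y0) h; rewrite e.
by nra.
Qed.

(** This fixes [kappa]: [p * r <= p * ln t / th + 4 * p] is at most [150 + 4] times
    [10 ^- 7 * g ^- 2 * ln m], and [288 * 154 * 10 ^- 7 <= 1 / 200]. *)
Lemma biased_total_le th d m p t g : 0 < g -> (2 <= th)%N -> (d <= 150 * th)%N ->
  p%:R <= 10 ^- 7 * g ^- 2 * ln m%:R ->
  p%:R * ln t%:R <= 10 ^- 7 * g ^- 2 * d%:R * ln m%:R ->
  288 * g ^+ 2 * (p * biased_count th t)%:R <= ln m%:R / 200.
Proof.
have aux (x v q u : R) : q <= u -> x <= v + 4 * q -> v <= 150 * u -> x <= 154 * u.
  by lra.
move=> g0 th2 dth pm ptm; have thR : 2 <= th%:R :> R by rewrite (ler_nat R 2).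
have [_ r1] := biased_count_bounds t th2.
have L0 := ln_natr_ge0 m.
have g2 : 0 < g ^+ 2 by rewrite exprn_gt0.
have dthR : d%:R <= 150 * th%:R :> R by rewrite -natrM ler_nat.
have pr : (p * biased_count th t)%:R <= p%:R * ln t%:R / th%:R + 4 * p%:R :> R.
  rewrite natrM; have := ler_wpM2l (ler0n R p) r1.
  by rewrite mulrDr mulrA; lra.
have pt150 : p%:R * ln t%:R / th%:R <= 150 * (10 ^- 7 * g ^- 2 * ln m%:R).
  rewrite ler_pdivrMr; last by lra.
  apply: le_trans ptm _.
  have c0 : 0 <= 10 ^- 7 * g ^- 2 * ln m%:R.
    by rewrite !mulr_ge0 // invr_ge0 ?exprn_ge0 ?ltW.
  have := ler_wpM2l c0 dthR; lra.
apply: (@le_trans _ _ (288 * g ^+ 2 * (154 * (10 ^- 7 * g ^- 2 * ln m%:R)))).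
  rewrite ler_wpM2l //; first by rewrite mulr_ge0 // ltW.
  exact: aux pm pr pt150.
rewrite [leLHS](_ : _ = 288 * 154 * 10 ^- 7 * ln m%:R); last first.
  by field; rewrite gt_eqF.
have : 288 * 154 * 10 ^- 7 <= 1 / 200 :> R by rewrite ler_pdivrMr; lra.
move=> /(ler_wpM2r L0); lra.
Qed.

End Constants.

Lemma div100_bounds d : (200 <= d)%N ->
  [/\ 2 <= d %/ 100, 100 * (d %/ 100) <= d & d <= 150 * (d %/ 100)]%N.
Proof. by move=> d200; split; lia. Qed.

Lemma realization (R : realType) (X J : finType) (d p : nat) (g : R)
    (c : {ffun X -> bool}) (G : pool X J p) :
  (d <= #|X|)%N -> ((p * #|J|).+1 < 2 ^ d)%N -> 2 * g <= 1 ->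
  exists H : set (classifier X),
    has_VC_dim H d /\ weak_learner g c H (respond g p c c G).
Proof.
move=> dX szp g1.
pose F := c :: [seq G k.1 k.2 | k <- enum {: 'I_p * J}].
exists (padded_class d F); split.
  by apply: padded_class_VC; rewrite //= size_map -cardE card_prod card_ord.
apply: padded_class_weak_learner => // [|i j]; rewrite inE ?eqxx //.
by apply/orP; right; apply/mapP; exists (i, j); rewrite ?mem_enum.
Qed.

Theorem theorem1p2 (R : realType) :
  exists C kappa : R, 1 <= C /\ 0 < kappa /\
  forall (gamma : R) (d m p t : nat) (A : forall X : choiceType, learner R m X),
    0 < gamma -> gamma < 1 / C -> C <= d%:R -> C <= m%:R ->
    (forall X : choiceType, parallel_complexity (A X) p t) ->
    (forall X : choiceType, measurable_learner (A X)) ->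
    exists (X : choiceType) (D : dist R X) (c : classifier X)
           (H : set (classifier X)) (W : responder R X),
      [/\ has_VC_dim H d,
          weak_learner gamma c H W,
          measurable_responder W
        & (expected_loss (A X) D c W <= (m%:R `^ (- (1 / 100)))%:E)%E ->
          [\/ Num.min (expR (kappa * d%:R)) (kappa * gamma ^- 2 * ln m%:R)
                <= p%:R,
              expR (expR (kappa * d%:R)) <= t%:R
            | kappa * gamma ^- 2 * d%:R * ln m%:R <= p%:R * ln t%:R]].
Proof.
(* [C <= m] makes the 200th root of [m] exceed 128, the constant lost in the final comparison. *)
pose C : R := expR (200 * 128).
have C1 : 1 + 200 * 128 <= C by exact: expR_ge1Dx.
exists C, (10 ^- 7); split; first by lra.
split; first by rewrite invr_gt0 exprn_gt0.
move=> g d m p t A g0 gC Cd Cm Apt mA.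
have g20 : g <= 1 / 20.
  apply: le_trans (ltW gC) _; rewrite !mul1r lef_pV2 ?posrE; lra.
have d200 : (200 <= d)%N by rewrite -(ler_nat R); lra.
set Alt := or3 _ _ _.
(* If the alternative holds, any instance of VC-dimension [d] will do: with an empty pool the weak
   learner always returns the concept. *)
have [alt|nalt] := pselect Alt.
  pose c : {ffun 'I_d.+1 -> bool} := [ffun=> false].
  pose G : pool 'I_d.+1 unit 0 := [ffun=> [ffun=> c]].
  have [|||H [HVC Hweak]] := @realization R _ _ d 0 g c G.
  - by rewrite card_ord.
  - by rewrite mul0n -{1}(expn0 2) ltn_exp2l //; lia.
  - by lra.
  exists 'I_d.+1, (uniform_dist R ord0), c, H, (respond g 0 c c G).
  by split => //; exact: (measurable_respond ord0).
have [pd pm] : p%:R < expR (10 ^- 7 * d%:R) :> R /\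
    p%:R < 10 ^- 7 * g ^- 2 * ln m%:R.
  apply/andP; rewrite -lt_min ltNge; apply/negP => H; apply: nalt; exact: Or31.
have td : t%:R < expR (expR (10 ^- 7 * d%:R)) :> R.
  by rewrite ltNge; apply/negP => H; apply: nalt; exact: Or32.
have ptm : p%:R * ln t%:R < 10 ^- 7 * g ^- 2 * d%:R * ln m%:R.
  by rewrite ltNge; apply/negP => H; apply: nalt; exact: Or33.
pose th := (d %/ 100)%N.
have [th2 thd dth] := div100_bounds d200.
have d10 : 10 ^- 7 * d%:R <= th%:R :> R.
  have : d%:R <= 150 * th%:R :> R by rewrite -natrM ler_nat.
  have : 0 <= th%:R :> R by [].
  move: (d%:R) (th%:R : R) => x y y0 xy; clear -y0 xy.
  by rewrite mulrC ler_pdivrMr ?exprn_gt0 //; lra.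
have pth : p%:R <= expR th%:R :> R.
  by apply: (le_trans (ltW pd)); rewrite ler_expR.
have tth : ln t%:R <= expR th%:R :> R.
  rewrite -ler_expR.
  apply: (@le_trans _ _ (expR (expR (10 ^- 7 * d%:R)))); last by rewrite !ler_expR.
  case: t td {Apt nalt ptm Alt} => [|t] td; first by rewrite ln0 // ler_expR expR_ge0.
  by rewrite lnK ?posrE ?ltr0n // ltW.
pose r := biased_count R th t; pose l := uniform_count R th.
pose bias : 'I_r + 'I_l -> R := @sum_bias R g r l.
pose ov := overlap (column_bias (p := p) bias).
have ovm : expR (- (ln m%:R / 200)) / 2 <= ov.
  apply: le_trans (overlap_ge_expR r l p g0 g20); rewrite ler_wpM2r //.
  rewrite ler_expR lerN2.
  exact: biased_total_le g0 th2 dth (ltW pm) (ltW ptm).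
have ov0 : 0 < ov by apply: lt_le_trans ovm; rewrite divr_gt0 ?expR_gt0.
(* The learner is given on all domains, so the domain may depend on [p] and [t]. The terms make room
   for the padding, leave half of the points unseen, and ensure [32 <= ov * #|X|]. *)
pose n := (d + 2 * m + Num.truncn (32 / ov))%N.
pose X : finType := 'I_n.+1.
have Xm : (2 * m <= #|X|)%N by rewrite card_ord /n; clear; lia.
have Xd : (d <= #|X|)%N by rewrite card_ord /n; clear; lia.
have Xov : 32 <= ov * #|X|%:R.
  rewrite mulrC -ler_pdivrMr // card_ord; apply: (@le_trans _ _ (Num.truncn (32 / ov)).+1%:R).
    have /truncn_itv/andP[_ /ltW //] : 0 <= 32 / ov by rewrite divr_ge0 // ltW.
  by rewrite ler_nat ltnS /n leq_addl.
pose D := uniform_dist R (ord0 : X).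
pose J : finType := ('I_r + 'I_l)%type.
have szp : ((p * #|J|).+1 < 2 ^ d)%N.
  by rewrite card_sum !card_ord; exact: pool_size_small th2 thd pth tth.
pose Omega := ({ffun X -> bool} * pool X J p)%type.
(* One outcome with large expected loss suffices, the implication being then vacuous. *)
have [[cG loss_cG]|small] := pselect (exists o : Omega,
    ((m%:R `^ (- (1 / 100)))%:E <
     expected_loss (A X) D o.1 (respond g p o.1 o.1 o.2))%E).
  have [|H [HVC Hweak]] := @realization R _ _ d p g cG.1 cG.2 Xd szp; first by lra.
  exists X, D, cG.1, H, (respond g p cG.1 cG.1 cG.2); split => //.
    exact: (measurable_respond ord0).
  by rewrite leNgt loss_cG.
exfalso.
have bias1 j : `|bias j| <= 1 by exact: sum_bias_le1.
pose b := round_failure_bound R th r l.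
have b0 : 0 <= b by rewrite addr_ge0 ?expR_ge0.
have ptb : p%:R * t%:R * b <= 1 / 2 by exact: union_bound_small.
have unansweredP (c : {ffun X -> bool}) (D' : dist R X) :
    \sum_(a : batch X J | [forall j, corr D' c (a j) < 2 * g])
      batch_law bias c a <= b.
  by apply: round_failure => //; [exact: mass_ge0|exact: dist_sum1|lra].
have : ov / 64 <= m%:R `^ (- (1 / 100)).
  apply: (@averaging R X m (A X) D (mA X) Omega
    (fun o => concept_law R o.1 * pool_law bias o.1 o.2)
    (fun o => o.1 : X -> bool) (fun o => respond g p o.1 o.1 o.2)).
  - by move=> o; rewrite mulr_ge0 ?concept_law_ge0 ?pool_law_ge0.
  - rewrite -(pair_bigA _ (fun c G => concept_law R c * pool_law bias c G)) /=.
    rewrite -[RHS](sum_concept_law R X); apply: eq_bigr => c _.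
    by rewrite -mulr_sumr sum_pool_law mulr1.
  - by move=> o; exact: (measurable_respond ord0).
  - move=> w S; exact: (mean_error_ge ord0 (Apt X) bias1 b0 unansweredP ptb w S Xm Xov).
  - by move=> o; rewrite leNgt; apply/negP => H; apply: small; exists o.
have m0 : 0 < m%:R :> R by lra.
(* With [y = expR (- (ln m / 200))], [y / 128 <= ov / 64 <= y * y] forces [1 / 128 <= y], against
   [1 / y >= 129]. *)
rewrite /powR gt_eqF // => H.
have Lm : 200 * 128 <= ln m%:R :> R by rewrite -ler_expR lnK.
have e2 : expR (- (1 / 100) * ln m%:R) =
    expR (- (ln m%:R / 200)) * expR (- (ln m%:R / 200)) :> R.
  by rewrite -expRD; congr expR; lra.
have y1 : expR (- (ln m%:R / 200)) * expR (ln m%:R / 200) = 1 :> R.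
  by rewrite -expRD addNr expR0.
have z1 : 129 <= expR (ln m%:R / 200) :> R.
  by apply: le_trans (expR_ge1Dx _); lra.
rewrite e2 in H; have y0 := expR_gt0 (- (ln m%:R / 200) : R).
move: (expR (- (ln m%:R / 200) : R)) (expR (ln m%:R / 200 : R)) y0 y1 z1 ovm H => y z.
move: (ov) => o; clear => y0 y1 z1 ovm H.
have : y / 128 <= y * y by lra.
rewrite ler_pM2l // => y128.
have : 1 / 128 * 129 <= y * z by rewrite ler_pM //; lra.
by lra.
Qed.
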